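(* Let $\tau\in(0,1]$ and $\alpha\in(1,2]$ be related by $\tau=\frac{2(\alpha-1)}{\alpha}$. Let $\mu$ be a probability measure on $\mathbb R^d$ satisfying Inequality $I(\tau)$. Then there exist constants $B_1,C_1,B_2,C_2$ such that for all smooth $f,g$ $$\int_{\mathbb R^d} g^2F_\tau\left(\frac{g^2}{\int_{\mathbb R^d}g^2\,d\mu}\right)d\mu\le B_1\int_{\mathbb R^d}g^2\,d\mu+C_1\int_{\mathbb R^d}|\nabla g|^2\,d\mu, \qquad (1)$$ $$\mathrm{Ent}_\mu(f^2)\le B_2\int_{\mathbb R^d}f^2\,d\mu+C_2\int_{\mathbb R^d}f^2\,c_\alpha^*\left(\left|\frac{\nabla f}{f}\right|\right)d\mu. \qquad (2)$$ If $\mu$ also satisfies a local Poincaré inequality, then (1) and (2) can be tightened, i.e. there are constants $C_1, C_2$ for which they hold with $B_1=B_2=0$.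
   Context: $\mu$ is absolutely continuous with respect to Lebesgue measure. $\mathrm{Ent}_\mu(f^2)=\int f^2\log\left(f^2/\int f^2d\mu\right)d\mu$. Inequality $I(\tau)$: there exist constants $B,C$ such that for every smooth $f$, $\mathrm{Ent}_\mu(f^2)\le B\int f^2d\mu+C\int|\nabla f|^2\log^{1-\tau}\left(e+\frac{f^2}{\int f^2d\mu}\right)d\mu$. $F_\tau(t)=\log^\tau(1+t)-\log^\tau(2)$ for $t\ge0$. For $\alpha>1$, $c_\alpha(t)=t^2/2$ if $|t|\le1$ and $c_\alpha(t)=\frac{|t|^\alpha}{\alpha}+\frac{\alpha-2}{2\alpha}$ if $|t|\ge1$; $c_\alpha^*(x)=\sup_y(xy-c_\alpha(y))$ is its convex conjugate, which equals $c_{\alpha^*}$ with $\frac1\alpha+\frac1{\alpha^*}=1$. Local Poincaré inequality: for every $\eta\in(0,1)$ there is a set $A$ with $\mu(A)\ge\eta$ and a constant $C_A<\infty$ such that $\mu_A=\frac{\mathbf 1_A}{\mu(A)}\mu$ satisfies $\int|f-\int f d\mu_A|^2d\mu_A\le C_A\int|\nabla f|^2d\mu_A$ for every smooth $f$. *)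

(* Defs.v *)
From HB Require Import structures.
From mathcomp Require Import all_boot all_order all_algebra.
From mathcomp Require Import all_classical all_reals all_analysis.

Set Implicit Arguments.
Unset Strict Implicit.
Unset Printing Implicit Defensive.
Import Order.TTheory GRing.Theory Num.Theory.
Import numFieldNormedType.Exports.

Local Open Scope classical_set_scope.
Local Open Scope ring_scope.

(* The sigma-algebra on R^n generated by the coordinate functions, i.e. the
   Borel sigma-algebra.  It has the same shape as the library's instance on
   n.-tuple, but lives on the normed module 'rV[R]_n, where derivatives are
   available. *)
Section measurable_rV.
Context {R : realType} (n : nat).

Definition rV_coord (i : 'I_n) (x : 'rV[R]_n) : R := x ord0 i.

Let rV_set0 : g_sigma_preimage rV_coord set0.
Proof. exact: sigma_algebra0. Qed.

Let rV_setC A : g_sigma_preimage rV_coord A -> g_sigma_preimage rV_coord (~` A).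
Proof. exact: sigma_algebraC. Qed.

Let rV_bigcup (F : (set 'rV[R]_n)^nat) :
  (forall i, g_sigma_preimage rV_coord (F i)) ->
  g_sigma_preimage rV_coord (\bigcup_i (F i)).
Proof. exact: sigma_algebra_bigcup. Qed.

HB.instance Definition _ := @isMeasurable.Build
  (measure_tuple_display default_measure_display)
  'rV[R]_n (g_sigma_preimage rV_coord) rV_set0 rV_setC rV_bigcup.

Lemma measurable_rV_coord (i : 'I_n) : measurable_fun [set: 'rV[R]_n] (rV_coord i).
Proof.
move=> _ Y mY; rewrite setTI; apply: sub_sigma_algebra => /=.
rewrite -bigcup_seq/=; exists i => /=; first by rewrite mem_index_enum.
by exists Y => //; rewrite setTI.
Qed.

Lemma measurable_fun_rVP d (T : measurableType d) (f : T -> 'rV[R]_n) :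
  (forall i, measurable_fun [set: T] (rV_coord i \o f)) ->
  measurable_fun [set: T] f.
Proof.
move=> mf _ A mA; rewrite setTI.
have : preimage_set_system [set: T] f (g_sigma_preimage rV_coord) (f @^-1` A).
  by exists A => //; rewrite setTI.
rewrite -g_sigma_preimage_comp; apply: smallest_sub.
  exact: sigma_algebra_measurable.
rewrite -bigcup_seq => B [i _ [C mC <-]]; exact: mf.
Qed.

End measurable_rV.

Section rV_cons.
Context {R : realType} (n : nat).

Definition rV_cons (p : R * 'rV[R]_n) : 'rV[R]_n.+1 :=
  row_mx (p.1%:M : 'rV[R]_1) p.2.

Lemma rV_cons0 p : rV_cons p ord0 ord0 = p.1.
Proof.
have -> : ord0 = lshift n (ord0 : 'I_1) :> 'I_(1 + n) by exact/val_inj.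
by rewrite [LHS]row_mxEl mxE eqxx mulr1n.
Qed.

Lemma rV_consS p (i : 'I_n) : rV_cons p ord0 (lift ord0 i) = p.2 ord0 i.
Proof.
have -> : lift ord0 i = rshift 1 i :> 'I_(1 + n) by exact/val_inj.
by rewrite [LHS]row_mxEr.
Qed.

Lemma measurable_rV_cons :
  measurable_fun [set: measurableTypeR R * 'rV[R]_n] rV_cons.
Proof.
apply: measurable_fun_rVP => i; have [j ->|->] := unliftP ord0 i.
  rewrite (_ : _ \o _ = rV_coord j \o snd); last first.
    by apply/funext => p /=; rewrite /rV_coord rV_consS.
  apply: measurableT_comp; [exact: measurable_rV_coord|exact: measurable_snd].
rewrite (_ : _ \o _ = fst); first exact: measurable_fst.
by apply/funext => p /=; rewrite /rV_coord rV_cons0.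
Qed.

Lemma measurable_rV_uncons :
  measurable_fun [set: 'rV[R]_n.+1]
    (fun x : 'rV[R]_n.+1 =>
       (x ord0 ord0 : measurableTypeR R, \row_(i < n) x ord0 (lift ord0 i))).
Proof.
apply: measurable_fun_pair => /=; first exact: (measurable_rV_coord ord0).
apply: measurable_fun_rVP => i.
rewrite (_ : _ \o _ = rV_coord (lift ord0 i)); first exact: measurable_rV_coord.
by apply/funext => x /=; rewrite /rV_coord mxE.
Qed.

Lemma rV_uncons_consK (p : R * 'rV[R]_n) :
  (rV_cons p ord0 ord0, \row_(i < n) rV_cons p ord0 (lift ord0 i)) = p.
Proof.
case: p => a v; rewrite rV_cons0; congr pair.
by apply/rowP => i; rewrite mxE rV_consS.
Qed.

Variable m : {sigma_finite_measure set 'rV[R]_n -> \bar R}.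

Definition rV_cons_measure : set 'rV[R]_n.+1 -> \bar R :=
  pushforward (@lebesgue_measure R \x m)%E rV_cons.

Let measurable_rV_cons_preimage (A : set 'rV[R]_n.+1) : measurable A ->
  measurable (rV_cons @^-1` A : set (measurableTypeR R * 'rV[R]_n)).
Proof.
by move=> mA; rewrite -[X in measurable X]setTI; exact: measurable_rV_cons.
Qed.

Let rV_cons_measure0 : rV_cons_measure set0 = 0%E.
Proof. by rewrite /rV_cons_measure /pushforward preimage_set0 measure0. Qed.

Let rV_cons_measure_ge0 A : (0 <= rV_cons_measure A)%E.
Proof. by rewrite /rV_cons_measure /pushforward measure_ge0. Qed.

Let rV_cons_measure_sigma_additive : semi_sigma_additive rV_cons_measure.
Proof.
move=> F mF tF mUF; rewrite /rV_cons_measure /pushforward preimage_bigcup.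
apply: measure_semi_sigma_additive.
- by move=> i; exact: measurable_rV_cons_preimage.
- apply/trivIsetP => /= i j _ _ ij; rewrite -preimage_setI.
  by move/trivIsetP : tF => /(_ _ _ _ _ ij) ->//; rewrite preimage_set0.
- by rewrite -preimage_bigcup; exact: measurable_rV_cons_preimage.
Qed.

HB.instance Definition _ := isMeasure.Build _ _ _ rV_cons_measure
  rV_cons_measure0 rV_cons_measure_ge0 rV_cons_measure_sigma_additive.

Let lebesgue_prod_sigma_finite :
  sigma_finite setT (@lebesgue_measure R \x m)%E.
Proof.
have /sigma_finiteP[F [FT ndF Foo]] := sigma_finiteT (@lebesgue_measure R).
have /sigma_finiteP[G [GT ndG Goo]] := sigma_finiteT m.
exists (fun k => F k `*` G k).
  rewrite -setXTT FT GT predeqE => -[x y]; split.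
    move=> [/= [i _ Fix] [k _ Gky]]; exists (maxn i k) => //; split.
    - by move: x Fix; exact/subsetPset/ndF/leq_maxl.
    - by move: y Gky; exact/subsetPset/ndG/leq_maxr.
  by move=> [i _ []/= ? ?]; split; exists i.
move=> k; have [? ?] := Foo k; have [? ?] := Goo k.
split; first exact: measurableX.
by rewrite product_measure1E// lte_mul_pinfty// ge0_fin_numE.
Qed.

Let rV_cons_measure_sigma_finite : sigma_finite setT rV_cons_measure.
Proof.
have [F FT mF] := lebesgue_prod_sigma_finite.
pose u (x : 'rV[R]_n.+1) : measurableTypeR R * 'rV[R]_n :=
  (x ord0 ord0, \row_(i < n) x ord0 (lift ord0 i)).
exists (fun k => u @^-1` F k).
  by rewrite -preimage_bigcup -FT preimage_setT.
move=> k; have [mFk Fkoo] := mF k; split.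
  by rewrite -[X in measurable X]setTI; exact: measurable_rV_uncons.
rewrite /rV_cons_measure /pushforward -comp_preimage.
rewrite (_ : u \o rV_cons = id)//.
by apply/funext => p /=; exact: rV_uncons_consK.
Qed.

HB.instance Definition _ := Measure_isSigmaFinite.Build _ _ _ rV_cons_measure
  rV_cons_measure_sigma_finite.

End rV_cons.

(* Lebesgue measure on R^n, as the iterated product of the one-dimensional
   Lebesgue measure; R^0 is a point, of mass 1. *)
Fixpoint lebesgue_rV {R : realType} (n : nat) :
    {sigma_finite_measure set 'rV[R]_n -> \bar R} :=
  match n with
  | 0 => \d_(0 : 'rV[R]_0)
  | n'.+1 => rV_cons_measure (lebesgue_rV n')
  end.

Section calculus.
Context {R : realType} (d : nat).
Implicit Types (f : 'rV[R]_d -> R) (x v : 'rV[R]_d).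

(* The Euclidean norm; the library's norm on 'rV[R]_d is the sup norm. *)
Definition norm2 v : R := Num.sqrt (\sum_(i < d) v ord0 i ^+ 2).

Definition partial (i : 'I_d) f : 'rV[R]_d -> R :=
  fun x => 'D_(delta_mx ord0 i) f x.

Definition grad f x : 'rV[R]_d := \row_(i < d) partial i f x.

Fixpoint is_C (k : nat) f : Prop :=
  match k with
  | 0 => continuous f
  | k'.+1 => (forall x, differentiable f x) /\
             (forall i, is_C k' (partial i f))
  end.

Definition smooth f : Prop := forall k, is_C k f.

End calculus.

Section inequalities.
Context {R : realType} (d : nat).
Implicit Types (mu nu : probability 'rV[R]_d R) (f g h : 'rV[R]_d -> R).
Implicit Types (alpha tau B C : R).

(* The functionals below are extended-real integrals. For f^2 integrable their
   integrands are bounded below by a constant multiple of f^2 + \int f^2, so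
   that the integrals are well defined in ]-oo, +oo]; for f^2 not integrable
   the quotient f^2 / \int f^2 has no meaning. *)
Definition smoothL2 mu f : Prop :=
  smooth f /\ mu.-integrable [set: 'rV[R]_d] (EFin \o (fun x => f x ^+ 2)).

(* For h >= 0: \int h log (h / \int h), with 0 log 0 = 0; when \int h = 0, h vanishes
   almost everywhere and the entropy is 0. *)
Definition Ent mu h : \bar R :=
  (\int[mu]_x (h x * ln (h x / (\int[mu]_y h y)%R))%:E)%E.

Definition ineq_I mu tau : Prop :=
  exists B C : R, forall f, smoothL2 mu f ->
    (Ent mu (fun x => (f x ^+ 2)%R)
     <= (B * \int[mu]_x (f x ^+ 2))%:E
        + C%:E * \int[mu]_x
            (norm2 (grad f x) ^+ 2 *
             (ln (expR 1 + f x ^+ 2 / (\int[mu]_y (f y ^+ 2))%R))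
               `^ (1 - tau))%:E)%E.

Definition F_ tau (t : R) : R := ln (1 + t) `^ tau - ln 2 `^ tau.

Definition ineq_F mu tau B C : Prop :=
  forall g, smoothL2 mu g ->
    (\int[mu]_x (g x ^+ 2 * F_ tau (g x ^+ 2 / (\int[mu]_y (g y ^+ 2))%R))%:E
     <= (B * \int[mu]_x (g x ^+ 2))%:E
        + C%:E * \int[mu]_x (norm2 (grad g x) ^+ 2)%:E)%E.

Definition cost alpha (t : R) : R :=
  if `|t| <= 1 then t ^+ 2 / 2
  else `|t| `^ alpha / alpha + (alpha - 2) / (2 * alpha).

(* For c = cost alpha with alpha > 1 the set is nonempty and bounded above, so
   that [sup] is its genuine supremum. *)
Definition conjugate (c : R -> R) (x : R) : R :=
  sup [set x * y - c y | y in [set: R]].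

(* Where f x = 0 the last integrand is 0, because of the factor f x ^+ 2. The
   value chosen there is immaterial when mu is absolutely continuous: for f
   smooth, f = 0 and grad f <> 0 hold together only on a Lebesgue-null set. *)
Definition ineq_mLS mu alpha B C : Prop :=
  forall f, smoothL2 mu f ->
    (Ent mu (fun x => (f x ^+ 2)%R)
     <= (B * \int[mu]_x (f x ^+ 2))%:E
        + C%:E * \int[mu]_x
            (f x ^+ 2 *
             conjugate (cost alpha) (norm2 ((f x)^-1 *: grad f x)))%:E)%E.

Definition poincare nu C : Prop :=
  forall f, smooth f -> nu.-integrable [set: 'rV[R]_d] (EFin \o f) ->
    (\int[nu]_x (`|f x - (\int[nu]_y f y)%R| ^+ 2)%:E
     <= C%:E * \int[nu]_x (norm2 (grad f x) ^+ 2)%:E)%E.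

(* 1_A / mu(A) * mu; the last argument of [mnormalize] is a default measure,
   used only when mu(A) = 0. *)
Definition conditional mu (A : set 'rV[R]_d) (mA : measurable A) :
    probability 'rV[R]_d R :=
  mnormalize (mrestr mu mA) mu.

Definition local_poincare mu : Prop :=
  forall eta : R, 0 < eta < 1 ->
    exists (A : set 'rV[R]_d) (mA : measurable A) (C_A : R),
      (eta%:E <= mu A)%E /\ poincare (conditional mu mA) C_A.

End inequalities.

(* Main.v *)
Require Import Defs.
From mathcomp Require Import all_boot all_order all_algebra.
From mathcomp Require Import all_classical all_reals all_analysis.
From mathcomp Require Import measurable_realfun ring lra.

(** Write L = ln(e + f^2) for f normalized by int f^2 = 1, E(f) for the
    integral of |grad f|^2, and beta = 2 / tau = alpha / (alpha - 1).

    Inequality (1) with a defect comes from inserting into I(tau) the function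
    f = G / (ln G^2)^((1 - tau) / 2) with G^2 = e^2 + g^2: the gradient of f
    carries exactly the power of the logarithm that cancels the weight
    ln^(1 - tau), so the right-hand side becomes E(g), while
    f^2 ln f^2 >= tau g^2 ln^tau (1 + g^2).  Since 1 <= f^2 <= e^2 + g^2, the
    mass of f^2 lies between two constants, and normalizing it costs a constant
    only ([defective_F]).

    Inequality (2) with a defect comes from Young's inequality
    x^2 L^(1 - tau) <= eps L + C x^beta, applied to x = |grad f| / |f|: the
    term int f^2 L is absorbed by the entropy.  This requires that it be
    finite, so it is done for bounded approximations of f, which satisfy
    |grad h| / h <= |grad f| / |f| ([defective_log]).  The cost enters at the
    very end, through x^beta <= beta c*(x) and x^2 <= beta c*(x)
    ([conjugate_lower]).  The functions substituted for f in the proof of (2)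
    are smooth functions of f^2, so their gradients vanish where f does, and the
    zeros of f contribute nothing on either side.

    For the tight inequalities, the defective (1) bounds the mass of f^2 on any
    set of small measure, because ln^tau (1 + t) tends to infinity; outside of
    such a set the local Poincare inequality applies, and together they give a
    Poincare inequality for mu ([poincare_normalized]).  Then each entropy is
    split: where |f| <= 2 it is, up to a multiple of f^2 - 1, whose integral is
    0, at most a multiple of (|f| - 1)^2, hence controlled by the variance;
    where |f| > 2 the defective inequality is applied to a function whose square
    is comparable to f^2 there and whose total mass is bounded by the variance,
    which turns the defect into a variance as well.  This function is f - int f
    for (1).  For (2) it has to vanish to an order at least beta / 2 where
    |f| = 1, so that its energy of exponent beta is finite; [excess] is such a
    function of f. *)

Set Implicit Arguments.
Unset Strict Implicit.
Unset Printing Implicit Defensive.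
Import Order.TTheory GRing.Theory Num.Theory.
Import numFieldNormedType.Exports.
Local Open Scope classical_set_scope.
Local Open Scope ring_scope.

(** * Measurability and calculus on row vectors *)

Section measurability.
Context {R : realType} (d : nat).

Lemma measurable_rV_ball (q : 'rV[R]_d) (e : R) : 0 < e -> measurable (ball q e).
Proof.
move=> e0.
rewrite (_ : ball q e =
    \bigcap_(i in [set: 'I_d]) (rV_coord i @^-1` ball (q ord0 i) e)).
  apply: fin_bigcap_measurable => // i _.
  rewrite -[X in measurable X]setTI; apply: measurable_rV_coord => //.
  by apply: open_measurable; exact: ball_open.
apply/seteqP; split => [y [_ qy] i _|y qy] /=; first exact: qy.
by split => // i j; rewrite (ord1 i); exact: qy.
Qed.

(** The norm on row vectors is the sup norm, so a ball is a box, that is, an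
    intersection of preimages under the coordinates; an open set is the union
    of the countably many balls with rational centre and radius 1/(n+1) that it
    contains. *)
Lemma rV_open_measurable (A : set 'rV[R]_d) : open A -> measurable A.
Proof.
move=> oA.
pose B (p : 'rV[rat]_d * nat) : set 'rV[R]_d :=
  ball (map_mx (@ratr R) p.1) (p.2.+1%:R^-1).
rewrite (_ : A = \bigcup_(p in [set: 'rV[rat]_d * nat])
    (if `[< B p `<=` A >] then B p else set0)).
  apply: countable_bigcupT_measurable; first exact: countableP.
  by move=> p; case: ifPn => // _; apply: measurable_rV_ball; rewrite invr_gt0.
apply/seteqP; split => [x Ax|x [p _]]; last by case: asboolP => // BA; exact: BA.
have /nbhs_ballP[e /= e0 xA] := open_nbhs_nbhs (conj oA Ax).
(* A rational ball of radius below e / 2 that contains x lies in the e-ball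
   around x. *)
have [n ne] : exists n, n.+1%:R^-1 < e / 2 :> R.
  have e2 : 0 < e / 2 by rewrite divr_gt0.
  have [n _ /(_ n (leqnn _))/= ] := near_infty_natSinv_lt (PosNum e2).
  by exists n.
have n0 : 0 < n.+1%:R^-1 :> R by rewrite invr_gt0.
have qP i : exists q : rat, `|ratr q - x ord0 i| < n.+1%:R^-1.
  have /rat_in_itvoo[q] : x ord0 i - n.+1%:R^-1 < x ord0 i + n.+1%:R^-1.
    by rewrite ltrBlDr -addrA ltrDl addr_gt0.
  by rewrite inE/= => /itvP h; exists q; rewrite ltr_distl !h.
pose q : 'rV[rat]_d := \row_i sval (cid (qP i)).
have Bx : B (q, n) x.
  split => // i j; rewrite /ball/= !mxE (ord1 i).
  exact: (svalP (cid (qP j))).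
exists (q, n) => //; case: asboolP => // -[] y [_ By]; apply: xA; split => // i j.
have := By i j; have := Bx.2 i j; rewrite /ball/= => h1 h2.
rewrite (_ : x i j - y i j = (map_mx ratr q i j - y i j) - (map_mx ratr q i j - x i j)); last by lra.
rewrite (le_lt_trans (ler_normB _ _))// [e]splitr ltrD// (lt_trans _ ne)//.
Qed.

Lemma rV_continuous_measurable (f : 'rV[R]_d -> R) :
  continuous f -> measurable_fun [set: 'rV[R]_d] f.
Proof.
move=> /continuousP cf; apply: (measurability _ (RGenOpens.measurableE R)).
move=> _ [_ [a [b ->] <-]]; rewrite setTI; apply: rV_open_measurable.
exact/cf/interval_open.
Qed.

(** Writing x^-1 as x (x^2)^(-1), which is correct at 0 too, reduces inversion
    to a real power, and these are measurable on the whole line. *)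
Lemma measurable_inv_fun dT (T : measurableType dT) (f : T -> R) :
  measurable_fun setT f -> measurable_fun setT (fun x => (f x)^-1).
Proof.
move=> mf.
have -> : (fun x => (f x)^-1) = (fun x => f x * ((f x ^+ 2) `^ (-1))).
  apply/funext => x; rewrite powR_inv1 ?sqr_ge0//.
  by have [->|x0] := eqVneq (f x) 0; [rewrite invr0 mul0r|field].
apply: measurable_funM => //.
apply: (measurableT_comp (@measurable_powR R (-1))) => //.
exact: measurable_funX.
Qed.

End measurability.

Section calculus.
Context {R : realType} (d : nat).
Implicit Types f g : 'rV[R]_d -> R.

Lemma is_C_continuous k f : is_C k f -> continuous f.
Proof. by case: k => [//|k] [df _] x; exact: differentiable_continuous. Qed.

Lemma is_CS k f : is_C k.+1 f -> is_C k f.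
Proof.
elim: k f => [f /is_C_continuous//|k IH f [df pf]].
by split => // i; apply/IH/pf.
Qed.

Lemma is_C_cst k (a : R) : is_C k (fun _ : 'rV[R]_d => a).
Proof.
elim: k a => [|k IH] a /=; first by move=> x; exact: cst_continuous.
split=> [x|i]; first exact: differentiable_cst.
rewrite (_ : partial _ _ = fun=> 0)//.
by apply/funext => x; rewrite /partial derive_cst.
Qed.

Lemma is_CD k f g : is_C k f -> is_C k g -> is_C k (fun x => f x + g x).
Proof.
elim: k f g => [|k IH] f g /=.
  by move=> cf cg x; apply: continuousD; [exact: cf|exact: cg].
move=> [df pf] [dg pg]; split => [x|i]; first exact: differentiableD.
rewrite (_ : partial _ _ = fun x => partial i f x + partial i g x); first exact: IH.
apply/funext => x; rewrite /partial; apply: deriveD; exact/diff_derivable.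
Qed.

Lemma is_CM k f g : is_C k f -> is_C k g -> is_C k (fun x => f x * g x).
Proof.
elim: k f g => [|k IH] f g.
  by move=> cf cg x; apply: continuousM; [exact: cf|exact: cg].
move=> Cf Cg; have [[df pf] [dg pg]] := (Cf, Cg).
split => [x|i]; first exact: differentiableM.
rewrite (_ : partial _ _ =
  fun x => f x * partial i g x + g x * partial i f x).
  by apply: is_CD; apply: IH; by [exact: is_CS|exact: pg|exact: pf].
apply/funext => x; rewrite /partial.
by rewrite (@deriveM _ _ f g)//; exact/diff_derivable.
Qed.

Lemma derive_comp_scalar f (H : R -> R) (l : R) x v :
  differentiable f x -> is_derive (f x) 1 H l ->
  differentiable (H \o f) x /\ 'D_v (H \o f) x = l * 'D_v f x.
Proof.
move=> df [dH Hl].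
have dH' : differentiable H (f x) by exact/derivable1_diffP.
split; first exact: differentiable_comp.
have dHf : differentiable (H \o f) x by exact: differentiable_comp.
rewrite (deriveE v dHf) (deriveE v df) (diff_comp df dH') /comp deriv1E//.
by rewrite derive1E Hl mulrC.
Qed.

(** Induction on k, for all exponents at once: differentiation lowers the
    exponent and brings out a partial derivative of f. *)
Lemma is_C_powR k f a : (forall x, 0 < f x) -> is_C k f ->
  is_C k (fun x => f x `^ a).
Proof.
move=> f0; elim: k a => [|k IH] a Cf.
  move=> x; apply: (@continuous_comp _ _ _ f (fun t => t `^ a)); first exact: Cf.
  have [h _] := is_derive1_powR a (f0 x).
  by apply: differentiable_continuous; exact/derivable1_diffP.
have [df pf] := Cf.
split => [x|i].
  by have [] := derive_comp_scalar 0 (df x) (is_derive1_powR a (f0 x)).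
rewrite (_ : partial _ _ = fun x => (a * f x `^ (a - 1)) * partial i f x).
  apply: is_CM; last exact: pf.
  by apply: is_CM; [exact: is_C_cst|apply: IH; exact: is_CS].
apply/funext => x.
by have [_] := derive_comp_scalar (delta_mx ord0 i) (df x) (is_derive1_powR a (f0 x)).
Qed.

Lemma is_C_ln k f : (forall x, 0 < f x) -> is_C k f ->
  is_C k (fun x => ln (f x)).
Proof.
move=> f0; case: k => [|k] Cf.
  move=> x; apply: (@continuous_comp _ _ _ f (@ln R)); first exact: Cf.
  exact: continuous_ln.
have [df pf] := Cf.
split => [x|i].
  by have [] := derive_comp_scalar 0 (df x) (is_derive1_ln (f0 x)).
rewrite (_ : partial _ _ = fun x => f x `^ (-1) * partial i f x).
  apply: is_CM; last exact: pf.
  by apply: is_C_powR => //; exact: is_CS.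
apply/funext => x; rewrite powR_inv1 ?ltW//.
by have [_] := derive_comp_scalar (delta_mx ord0 i) (df x) (is_derive1_ln (f0 x)).
Qed.

Lemma smooth_cst (a : R) : smooth (fun _ : 'rV[R]_d => a).
Proof. by move=> k; exact: is_C_cst. Qed.

Lemma smoothD f g : smooth f -> smooth g -> smooth (fun x => f x + g x).
Proof. by move=> Cf Cg k; exact: is_CD. Qed.

Lemma smoothM f g : smooth f -> smooth g -> smooth (fun x => f x * g x).
Proof. by move=> Cf Cg k; exact: is_CM. Qed.

Lemma smoothX f n : smooth f -> smooth (fun x => f x ^+ n).
Proof.
move=> Cf; elim: n => [|n IH]; first exact: smooth_cst.
rewrite (_ : (fun _ => _) = (fun x => f x * f x ^+ n)); first exact: smoothM.
by apply/funext => x; rewrite exprS.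
Qed.

Lemma smooth_powR f a : (forall x, 0 < f x) -> smooth f ->
  smooth (fun x => f x `^ a).
Proof. by move=> f0 Cf k; exact: is_C_powR. Qed.

Lemma smooth_ln f : (forall x, 0 < f x) -> smooth f ->
  smooth (fun x => ln (f x)).
Proof. by move=> f0 Cf k; exact: is_C_ln. Qed.

Lemma smooth_measurable f : smooth f -> measurable_fun setT f.
Proof. by move=> /(_ 0%N); exact: rV_continuous_measurable. Qed.

Lemma smooth_diff f x : smooth f -> differentiable f x.
Proof. by move=> /(_ 1%N)[]. Qed.

Lemma smooth_partial f i : smooth f -> smooth (partial i f).
Proof. by move=> Cf k; have [_ h] := Cf k.+1; exact: h. Qed.

Lemma grad_comp f (H : R -> R) (l : R) x :
  smooth f -> is_derive (f x) 1 H l ->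
  grad (fun y => H (f y)) x = l *: grad f x.
Proof.
move=> Cf dH; apply/rowP => i; rewrite !mxE /partial.
by have [_ ->] := derive_comp_scalar (delta_mx ord0 i) (smooth_diff x Cf) dH.
Qed.

Lemma norm2_ge0 (v : 'rV[R]_d) : 0 <= norm2 v.
Proof. exact: sqrtr_ge0. Qed.

Lemma norm2Z (a : R) (v : 'rV[R]_d) : norm2 (a *: v) = `|a| * norm2 v.
Proof.
rewrite /norm2 -sqrtr_sqr -sqrtrM ?sqr_ge0//; congr Num.sqrt.
by rewrite mulr_sumr; apply: eq_bigr => i _; rewrite mxE exprMn.
Qed.

Lemma measurable_norm2_grad f : smooth f ->
  measurable_fun setT (fun x => norm2 (grad f x)).
Proof.
move=> Cf; rewrite (_ : (fun _ => _) =
  (fun x => (\sum_(i < d) partial i f x ^+ 2) `^ 2^-1)).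
  apply: (measurableT_comp (@measurable_powR R 2^-1)) => //.
  apply: measurable_sum => i; apply: measurable_funX.
  by apply: smooth_measurable; exact: smooth_partial.
apply/funext => x; rewrite powR12_sqrt ?sumr_ge0// => [|i _]; last exact: sqr_ge0.
by congr Num.sqrt; apply: eq_bigr => i _; rewrite mxE.
Qed.

End calculus.

(** * Integrals of real-valued functions *)

Section integrals.
Context {R : realType} dT (T : measurableType dT) (mu : {measure set T -> \bar R}).
Implicit Types f g h : T -> R.
Local Notation meas f := (measurable_fun [set: T] f).
Local Notation I f := (\int[mu]_x (f x)%:E)%E.
Local Notation L1 f := (mu.-integrable [set: T] (EFin \o f)).

Lemma measurable_EFin f : meas f -> measurable_fun [set: T] (fun x => (f x)%:E).
Proof. by move=> ?; exact/measurable_EFinP. Qed.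

(** The integral is the difference of the integrals of the positive and negative
    parts; comparing these separately covers the infinite values. *)
Lemma le_int f g : meas f -> meas g -> (forall x, f x <= g x) -> (I f <= I g)%E.
Proof.
move=> mf mg fg; rewrite integralE [leRHS]integralE; apply: leeB.
- apply: ge0_le_integral => //.
  + exact/measurable_funepos/measurable_EFin.
  + exact/measurable_funepos/measurable_EFin.
  + move=> x _; apply: (@funepos_le _ _ setT (EFin \o f) (EFin \o g)).
      by move=> y _; rewrite lee_fin.
    by rewrite inE.
- apply: ge0_le_integral => //.
  + exact/measurable_funeneg/measurable_EFin.
  + exact/measurable_funeneg/measurable_EFin.
  + move=> x _; apply: (@funeneg_le _ _ setT (EFin \o f) (EFin \o g)).
      by move=> y _; rewrite lee_fin.
    by rewrite inE.
Qed.

(** The integral of a nonnegative function is a supremum over the simple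
    functions below it, which allows comparison with a g of unknown
    measurability, such as one built from a convex conjugate. *)
Lemma le_int_ge0 f g : (forall x, 0 <= f x) -> (forall x, f x <= g x) ->
  (I f <= I g)%E.
Proof.
move=> f0 fg.
rewrite !ge0_integralTE; [|by move=> x; rewrite lee_fin//; exact: le_trans (fg x)..].
apply: ereal_sup_le => _ [h /= hf <-]; exists h => //= x.
by apply: le_trans (hf x) _; rewrite lee_fin.
Qed.

Lemma int_ge0 f : (forall x, 0 <= f x) -> (0 <= I f)%E.
Proof. by move=> f0; apply: integral_ge0 => x _; rewrite lee_fin. Qed.

Lemma int_Zl (c : R) f : meas f -> 0 <= c -> (forall x, 0 <= f x) ->
  I (fun x => c * f x) = (c%:E * I f)%E.
Proof.
move=> mf c0 f0; rewrite -ge0_integralZl//.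
- exact: measurable_EFin.
- by move=> x _; rewrite lee_fin.
Qed.

Lemma int_D f g : meas f -> meas g -> (forall x, 0 <= f x) -> (forall x, 0 <= g x) ->
  I (fun x => f x + g x) = (I f + I g)%E.
Proof.
move=> mf mg f0 g0; rewrite -ge0_integralD//.
- by move=> x _; rewrite lee_fin.
- exact: measurable_EFin.
- by move=> x _; rewrite lee_fin.
- exact: measurable_EFin.
Qed.

Lemma L1_measurable f : L1 f -> meas f.
Proof. by move=> /measurable_int/measurable_EFinP. Qed.

Lemma int_L1 f : L1 f -> I f = (\int[mu]_x f x)%:E.
Proof. by move=> If; rewrite fineK//; exact: integrable_fin_num. Qed.

Lemma L1_ge0 f : meas f -> (forall x, 0 <= f x) -> (I f < +oo)%E -> L1 f.
Proof.
move=> mf f0 Ioo; apply/integrableP; split; first exact: measurable_EFin.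
by under eq_integral do rewrite /= ger0_norm//.
Qed.

Lemma L1_le f g : meas f -> L1 g -> (forall x, `|f x| <= g x) -> L1 f.
Proof.
move=> mf Lg fg; apply: (le_integrable measurableT (measurable_EFin mf) _ Lg).
move=> x _ /=; rewrite lee_fin (le_trans (fg x))// ler_norm//.
Qed.

(** If g is not integrable the right-hand side is +oo; otherwise j + g is
    integrable and the integral is additive. *)
Lemma int_upper j f g : meas f -> L1 j -> meas g -> (forall x, 0 <= g x) ->
  (forall x, f x <= j x + g x) -> (I f <= I j + I g)%E.
Proof.
move=> mf Lj mg g0 fjg.
have [|Ioo] := leP +oo%E (I g).
  by rewrite leye_eq => /eqP ->; rewrite (int_L1 Lj) addey ?leey.
have Lg : L1 g by exact: L1_ge0.
rewrite -(@integralD _ _ _ _ _ _ (EFin \o j) (EFin \o g))//.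
apply: (@le_int f (fun x => j x + g x)) => //.
by apply: measurable_funD => //; exact: L1_measurable.
Qed.

(** Unless the integral of g is +oo, the bound f - j <= g with f >= 0 makes the
    negative part of g integrable, and g with it; this turns a bound on an
    entropy into a bound on a nonnegative quantity. *)
Lemma int_lower j f g : meas f -> (forall x, 0 <= f x) -> meas g -> L1 j ->
  (forall x, f x <= g x + j x) -> (I f <= I g + I j)%E.
Proof.
move=> mf f0 mg Lj fgj.
have [|Ioo] := leP +oo%E (I g).
  by rewrite leye_eq => /eqP ->; rewrite (int_L1 Lj) addye ?leey.
have neg x : ((EFin \o g)^\-)%E x = (Order.max (- g x) 0)%:E.
  by rewrite funenegE/= -EFin_max.
have pos x : ((EFin \o g)^\+)%E x = (Order.max (g x) 0)%:E.
  by rewrite funeposE/= -EFin_max.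
have mm : measurable_fun [set: T] (fun x => Order.max (- g x) 0).
  by apply: measurable_maxr => //; exact: measurable_funN.
have mp : measurable_fun [set: T] (fun x => Order.max (g x) 0).
  exact: measurable_maxr.
have Ln : L1 (fun x => Order.max (- g x) 0).
  apply: (L1_le mm (g := fun x => `|j x|)) => [|x]; first exact: integrable_norm Lj.
  have := fgj x; have := f0 x; rewrite /=.
  rewrite ger0_norm ?le_max ?lexx ?orbT// ge_max normr_ge0 andbT.
  by move=> h1 h2; have := ler_norm (j x); lra.
have Lg : L1 g.
  have Lp : L1 (fun x => Order.max (g x) 0).
    apply: L1_ge0 => //; first by move=> x; rewrite le_max lexx orbT.
    rewrite ltNge leye_eq; apply/negP => /eqP Poo; move: Ioo.
    rewrite integralE (eq_integral _ _ (fun x _ => pos x)) Poo.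
    by rewrite (eq_integral _ _ (fun x _ => neg x)) (int_L1 Ln).
  have -> : EFin \o g = (fun x => (Order.max (g x) 0)%R%:E -
      (Order.max (- g x) 0)%R%:E)%E.
    apply/funext => x /=; rewrite -EFinB; congr EFin.
    by rewrite /Order.max; case: ifP; case: ifP; lra.
  exact: (integrableB measurableT Lp Ln).
rewrite -(@integralD _ _ _ _ _ _ (EFin \o g) (EFin \o j))//.
apply: (@le_int f (fun x => g x + j x)) => //.
by apply: measurable_funD => //; exact: L1_measurable.
Qed.

Lemma int_eq0_mul f g : meas f -> meas g -> (forall x, 0 <= f x) -> I f = 0%E ->
  I (fun x => f x * g x) = 0%E.
Proof.
move=> mf mg f0 If.
have /ae_eq_integral_abs : (\int[mu]_x `|(f x)%:E|)%E = 0%E.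
  by rewrite -[RHS]If; apply: eq_integral => x _; rewrite gee0_abs// lee_fin.
move=> /(_ measurableT (measurable_EFin mf)) ae0.
rewrite -(integral0 mu [set: T]); apply: ae_eq_integral => //.
  exact/measurable_EFin/measurable_funM.
apply: filterS ae0 => x /= /(_ Logic.I)[->] _.
by rewrite mul0r.
Qed.

End integrals.

(** * Scaling, monotone limits and normalization *)

Section signed.
Context {R : realType} dT (T : measurableType dT) (mu : {measure set T -> \bar R}).
Implicit Types f g h : T -> R.
Local Notation meas f := (measurable_fun [set: T] f).
Local Notation I f := (\int[mu]_x (f x)%:E)%E.
Local Notation L1 f := (mu.-integrable [set: T] (EFin \o f)).

(** The factorization holds also when one of the two parts of f, or both, has
    an infinite integral. *)
Lemma int_pZl (c : R) f : meas f -> 0 < c ->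
  I (fun x => c * f x) = (c%:E * I f)%E.
Proof.
move=> mf c0.
have pos g x : ((EFin \o g)^\+)%E x = (Order.max (g x) 0)%:E.
  by rewrite funeposE/= -EFin_max.
have neg g x : ((EFin \o g)^\-)%E x = (Order.max (- g x) 0)%:E.
  by rewrite funenegE/= -EFin_max.
rewrite integralE [in RHS]integralE.
rewrite !(eq_integral _ _ (fun x _ => pos _ x)) !(eq_integral _ _ (fun x _ => neg _ x)).
have mp : meas (fun x => Order.max (f x) 0) by exact: measurable_maxr.
have mn : meas (fun x => Order.max (- f x) 0).
  by apply: measurable_maxr => //; exact: measurable_funN.
have p0 x : 0 <= Order.max (f x) 0 by rewrite le_max lexx orbT.
have n0 x : 0 <= Order.max (- f x) 0 by rewrite le_max lexx orbT.
rewrite (_ : (\int[mu]_x (Order.max (c * f x) 0)%:E)%E =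
  (c%:E * I (fun x => Order.max (f x) 0))%E); last first.
  rewrite -int_Zl ?ltW//; apply: eq_integral => x _; congr EFin.
  by rewrite maxr_pMr ?ltW// mulr0.
rewrite (_ : (\int[mu]_x (Order.max (- (c * f x)) 0)%:E)%E =
  (c%:E * I (fun x => Order.max (- f x) 0))%E); last first.
  rewrite -int_Zl ?ltW//; apply: eq_integral => x _; congr EFin.
  by rewrite -mulrN maxr_pMr ?ltW// mulr0.
have := int_ge0 mu p0; have := int_ge0 mu n0.
case: (I (fun x => Order.max (- f x) 0)) => [a| |]//;
  case: (I (fun x => Order.max (f x) 0)) => [b| |]// _ _.
- by rewrite muleBr.
- by rewrite /= !gt0_muley ?lte_fin//.
- by rewrite /= gt0_muley ?lte_fin// gt0_muleNy ?lte_fin.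
- by rewrite /= gt0_muley ?lte_fin// gt0_muleNy ?lte_fin.
Qed.

(** Monotone convergence, in the form used to let a truncation level go to
    infinity. *)
Lemma int_nd_sup (f_ : nat -> T -> R) f (K : \bar R) :
  (forall n, meas (f_ n)) -> (forall n x, 0 <= f_ n x) ->
  (forall x, nondecreasing_seq (f_ ^~ x)) ->
  (forall x, f_ n x @[n --> \oo] --> f x) ->
  (forall n, (I (f_ n) <= K)%E) -> (I f <= K)%E.
Proof.
move=> mf f0 nd cv IK.
have cvf x : ((f_ n x)%:E @[n --> \oo] --> (f x)%:E)%E.
  by apply/fine_cvgP; split; [exact: nearW|exact: cv].
rewrite (_ : I f = (\int[mu]_x limn (fun n => (f_ n x)%:E))%E); last first.
  by apply: eq_integral => x _; apply/esym/cvg_lim.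
have mf' n : measurable_fun [set: T] (fun x => (f_ n x)%:E) by exact: measurable_EFin.
have h0 n x : [set: T] x -> (0 <= (f_ n x)%:E)%E by rewrite lee_fin.
have hnd x : [set: T] x -> {homo (fun n => (f_ n x)%:E) : n m / (n <= m)%N >-> (n <= m)%E}.
  by move=> _ n m nm; rewrite lee_fin; exact: nd.
have := cvg_monotone_convergence (mu := mu) measurableT mf' h0 hnd.
move=> /cvg_lim <-//.
apply: lime_le.
  apply: ereal_nondecreasing_is_cvgn => n m nm.
  by apply: le_int => // x; exact: nd.
by apply: nearW => n; exact: IK.
Qed.

End signed.

Section prob.
Context {R : realType} (d : nat) (mu : probability 'rV[R]_d R).
Implicit Types f g h : 'rV[R]_d -> R.
Local Notation meas f := (measurable_fun [set: 'rV[R]_d] f).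
Local Notation I f := (\int[mu]_x (f x)%:E)%E.
Local Notation L1 f := (mu.-integrable [set: 'rV[R]_d] (EFin \o f)).

Lemma L1_cst (a : R) : L1 (fun=> a).
Proof. exact: finite_measure_integrable_cst. Qed.

Lemma L1_affine (a b : R) f : L1 f -> L1 (fun x => a + b * f x).
Proof.
move=> Lf; have := integrableD measurableT (L1_cst a) (integrableZl measurableT b Lf).
by apply: eq_integrable.
Qed.

Lemma Rint_affine (a b : R) f : L1 f ->
  (\int[mu]_x (a + b * f x) = a + b * \int[mu]_x f x).
Proof.
move=> Lf; rewrite RintegralD//.
- rewrite RintegralZl// Rintegral_cst//; congr (_ + _).
  by rewrite -[RHS]mulr1; congr (_ * _); exact: (congr1 fine (@probability_setT _ _ _ mu)).
- exact: L1_cst.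
- have := integrableZl measurableT b Lf; exact: eq_integrable.
Qed.

Lemma L2_bound f h (a b : R) : smooth h -> smoothL2 mu f ->
  (forall x, h x ^+ 2 <= a + b * f x ^+ 2) -> smoothL2 mu h.
Proof.
move=> Ch [Cf Lf] hf; split => //.
apply: L1_le (L1_affine a b Lf) _.
  by apply: measurable_funX; exact: smooth_measurable.
by move=> x; rewrite ger0_norm ?sqr_ge0.
Qed.

Lemma smoothL2_Z (c : R) f : smoothL2 mu f -> smoothL2 mu (fun x => c * f x).
Proof.
move=> Lf; apply: (@L2_bound f _ 0 (c ^+ 2)) => //.
  by apply: smoothM; [exact: smooth_cst|case: Lf].
by move=> x; rewrite exprMn add0r.
Qed.

Lemma smoothL2_B (c : R) f : smoothL2 mu f -> smoothL2 mu (fun x => f x - c).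
Proof.
move=> Lf; apply: (@L2_bound f _ (2 * c ^+ 2) 2) => //.
  by apply: smoothD; [case: Lf|exact: smooth_cst].
by move=> x; have := sqr_ge0 (f x + c); nra.
Qed.

Lemma gradZ (c : R) f x : smooth f -> grad (fun y => c * f y) x = c *: grad f x.
Proof.
move=> Cf; apply: (@grad_comp _ _ f (fun t => c * t) c) => //.
have := is_deriveM (is_derive_cst c (f x) (1:R)) (is_derive_id (f x) (1:R)).
by move=> h; apply: is_derive_eq; rewrite /GRing.scale/= mulr0 addr0 mulr1.
Qed.

Lemma gradB (c : R) f x : smooth f -> grad (fun y => f y - c) x = grad f x.
Proof.
move=> Cf; rewrite -[RHS]scale1r.
apply: (@grad_comp _ _ f (fun t => t - c) 1) => //.
have h := is_deriveB (is_derive_id (f x) (1:R)) (is_derive_cst c (f x) (1:R)).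
by apply: is_derive_eq; rewrite subr0.
Qed.

Lemma smoothL2_L1 f : smoothL2 mu f -> L1 f.
Proof.
move=> [Cf Lf]; apply: (L1_le _ (L1_affine 1 1 Lf)); first exact: smooth_measurable.
by move=> x; rewrite ler_norml; apply/andP; split; nra.
Qed.

(** Both sides of the inequalities are quadratic in f, so they may be proved
    for int f^2 = 1.  When int f^2 = 0 no normalization is possible, but then
    f = 0 almost everywhere. *)
Section homogeneity.
Variable Psi : R -> R.
Hypothesis mPsi : measurable_fun [set: R] Psi.
Variable Q : ('rV[R]_d -> R) -> \bar R.
Hypothesis Q0 : forall f, (0 <= Q f)%E.
Hypothesis QZ : forall c f, c != 0 -> smooth f ->
  Q (fun x => c * f x) = ((c ^+ 2)%:E * Q f)%E.
Variables B C : R.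
Hypothesis B0 : 0 <= B.
Hypothesis C0 : 0 <= C.
Hypothesis H : forall u, smoothL2 mu u -> \int[mu]_x (u x ^+ 2) = 1 ->
  (I (fun x => u x ^+ 2 * Psi (u x ^+ 2)) <= B%:E + C%:E * Q u)%E.

Lemma homogenize f : smoothL2 mu f ->
  (I (fun x => (f x ^+ 2 * Psi (f x ^+ 2 / (\int[mu]_y (f y ^+ 2))%R))%R)
    <= (B * \int[mu]_y (f y ^+ 2))%:E + C%:E * Q f)%E.
Proof.
move=> Lf; have [Cf If] := Lf; set v := \int[mu]_y _.
have f2m : meas (fun x => f x ^+ 2) by apply: measurable_funX; exact: smooth_measurable.
have v0 : 0 <= v by apply: Rintegral_ge0 => x _; exact: sqr_ge0.
have mP w : meas (fun x => Psi (f x ^+ 2 / w)).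
  apply: (measurableT_comp mPsi); apply: measurable_funM => //.
have [vE|vN0] := eqVneq v 0.
  rewrite (int_eq0_mul f2m (mP v)); last 2 first.
  - by move=> x; exact: sqr_ge0.
  - by rewrite (int_L1 If) -/v vE.
  by rewrite vE mulr0 add0e mule_ge0.
have vp : 0 < v by rewrite lt_neqAle eq_sym vN0.
pose c := (Num.sqrt v)^-1.
have c2 : c ^+ 2 = v^-1 by rewrite /c exprVn sqr_sqrtr.
have c0 : c != 0 by rewrite invr_eq0 sqrtr_eq0 -ltNge.
pose u x := c * f x.
have u2 x : u x ^+ 2 = f x ^+ 2 / v by rewrite /u exprMn c2 mulrC.
have Lu : smoothL2 mu u by exact: smoothL2_Z.
have Iu : \int[mu]_x (u x ^+ 2) = 1.
  rewrite (_ : (fun x => u x ^+ 2) = (fun x => 0 + v^-1 * f x ^+ 2)).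
    by rewrite Rint_affine// add0r mulVf.
  by apply/funext => x; rewrite u2 add0r mulrC.
have mu2 : meas (fun x => u x ^+ 2 * Psi (u x ^+ 2)).
  apply: measurable_funM.
    by apply: measurable_funX; apply: smooth_measurable; case: Lu.
  by apply: eq_measurable_fun (mP v) => x _; rewrite u2.
have -> : I (fun x => f x ^+ 2 * Psi (f x ^+ 2 / v)) =
    (v%:E * I (fun x => u x ^+ 2 * Psi (u x ^+ 2)))%E.
  rewrite -int_pZl//; apply: eq_integral => x _; congr EFin.
  by rewrite u2; field.
apply: (@le_trans _ _ (v%:E * (B%:E + C%:E * Q u))%E).
  by apply: lee_wpmul2l; [rewrite lee_fin|exact: H].
rewrite QZ// c2 ge0_muleDr//; last by rewrite mule_ge0// mule_ge0// lee_fin invr_ge0.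
rewrite -EFinM [v * B]mulrC leeD2l// muleCA.
by rewrite [X in (_ * X)%E]muleA -EFinM mulfV// mul1e.
Qed.

Hypothesis Psi_nd : forall s t, 0 <= s -> s <= t -> Psi s <= Psi t.

(** For a nondecreasing Psi the mass may be replaced by any upper bound V.  The
    defect is then proportional to the true mass of f, and this is the mechanism
    that makes it small in the tightening. *)
Lemma homogenize_le f V : smoothL2 mu f -> 0 < V -> \int[mu]_y (f y ^+ 2) <= V ->
  (I (fun x => (f x ^+ 2 * Psi (f x ^+ 2 / V))%R)
    <= (B * \int[mu]_y (f y ^+ 2))%:E + C%:E * Q f)%E.
Proof.
move=> Lf V0 fV; have [Cf If] := Lf.
have f2m : meas (fun x => f x ^+ 2) by apply: measurable_funX; exact: smooth_measurable.
have mP w : meas (fun x => Psi (f x ^+ 2 / w)).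
  apply: (measurableT_comp mPsi); apply: measurable_funM => //.
have v0 : 0 <= \int[mu]_y (f y ^+ 2) by apply: Rintegral_ge0 => x _; exact: sqr_ge0.
have [vE|vN0] := eqVneq (\int[mu]_y (f y ^+ 2)) 0.
  rewrite (int_eq0_mul f2m (mP V)); last 2 first.
  - by move=> x; exact: sqr_ge0.
  - by rewrite (int_L1 If) vE.
  by rewrite vE mulr0 add0e mule_ge0.
apply: le_trans (homogenize Lf); apply: le_int => [||x].
- exact: measurable_funM.
- exact: measurable_funM.
- rewrite ler_wpM2l ?sqr_ge0//; apply: Psi_nd.
    by rewrite divr_ge0 ?sqr_ge0 ?ltW.
  by rewrite ler_wpM2l ?sqr_ge0// lef_pV2// posrE// lt_neqAle eq_sym vN0.
Qed.

End homogeneity.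
End prob.

(** * The substitution exchanging gradient weight and exponent *)

Section real_inequalities.
Context {R : realType}.
Implicit Types (t x y L tau s k : R).

Lemma expR1_ge2 : 2 <= expR 1 :> R.
Proof. by have := expR_ge1Dx (1 : R). Qed.

Lemma ln_le_sub1 x : 0 < x -> ln x <= x - 1.
Proof.
move=> x0; have := @le_ln1Dx R (x - 1).
by rewrite (_ : 1 + (x - 1) = x); [apply; lra|lra].
Qed.

Lemma powR_half_sqr x : 0 <= x -> (x `^ 2^-1) ^+ 2 = x.
Proof. by move=> x0; rewrite powR12_sqrt// sqr_sqrtr. Qed.

Lemma is_derive_sqrD (a t : R) : is_derive t 1 (fun y => a + y ^+ 2) (2 * t).
Proof.
by apply: is_derive_eq; rewrite /GRing.scale/=; ring.
Qed.

Definition sqD t := expR 2 + t ^+ 2.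
Definition logD t := ln (sqD t).
(** This is t / (ln t^2)^((1 - tau) / 2), up to the constant e^2, which makes
    it smooth and keeps the logarithm above 2. *)
Definition log_weight tau t := sqD t `^ 2^-1 * logD t `^ (- ((1 - tau) / 2)).

Lemma sqD_gt0 y : 0 < sqD y.
Proof. by rewrite ltr_wpDr ?sqr_ge0// expR_gt0. Qed.

Lemma logD_ge2 y : 2 <= logD y.
Proof.
by rewrite -[leLHS](@expRK R) ler_ln ?posrE ?expR_gt0 ?sqD_gt0// lerDl sqr_ge0.
Qed.

Lemma logD_gt0 y : 0 < logD y.
Proof. by have := logD_ge2 y; lra. Qed.

Lemma log_weight_sqr tau y : log_weight tau y ^+ 2 = sqD y * logD y `^ (tau - 1).
Proof.
rewrite /log_weight exprMn powR_half_sqr ?(ltW (sqD_gt0 _))//; congr (_ * _).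
rewrite expr2 -powRD; last by rewrite (gt_eqF (logD_gt0 y)) implybT.
by congr (_ `^ _); lra.
Qed.

Lemma log_weight_sqr_le tau y : 0 < tau -> tau <= 1 -> log_weight tau y ^+ 2 <= sqD y.
Proof.
move=> tau0 tau1.
rewrite log_weight_sqr ler_piMr ?(ltW (sqD_gt0 _))//.
rewrite -[leRHS](@powRr0 _ (logD y)); apply: ler_powR; last by lra.
by have := logD_ge2 y; lra.
Qed.

Lemma log_weight_sqr_ge1 tau y : 0 < tau -> tau <= 1 -> 1 <= log_weight tau y ^+ 2.
Proof.
move=> tau0 tau1.
rewrite log_weight_sqr -(opprB 1) powRN ler_pdivlMr ?powR_gt0 ?logD_gt0//.
rewrite mul1r (@le_trans _ _ (logD y))//; last exact/ltW/ln_sublinear/sqD_gt0.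
rewrite -[leRHS]powRr1 ?(ltW (logD_gt0 _))//; apply: ler_powR; last by lra.
by have := logD_ge2 y; lra.
Qed.

(** With L = [logD y], the inequality ln L <= L - 1 gives
    ln (log_weight^2) = L - (1 - tau) ln L >= tau L, and log_weight^2 L is the
    product of e^2 + y^2 and L^tau. *)
Lemma log_weight_entropy tau y : 0 < tau -> tau <= 1 ->
  tau * (y ^+ 2 * ln (1 + y ^+ 2) `^ tau) <=
  log_weight tau y ^+ 2 * ln (log_weight tau y ^+ 2).
Proof.
move=> tau0 tau1.
rewrite {1}log_weight_sqr.
have P0 := sqD_gt0 y; have L0 := logD_gt0 y; have L2 := logD_ge2 y.
have lnH : tau * logD y <= ln (log_weight tau y ^+ 2).
  rewrite log_weight_sqr lnM ?posrE ?powR_gt0// ln_powR -/(logD y).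
  have := ln_le_sub1 L0; nra.
apply: (@le_trans _ _ (sqD y * logD y `^ (tau - 1) * (tau * logD y))); last first.
  by rewrite ler_wpM2l// mulr_ge0 ?powR_ge0// ltW.
have -> : sqD y * logD y `^ (tau - 1) * (tau * logD y) = tau * (sqD y * logD y `^ tau).
  rewrite -[in RHS](@mulr_powRB1 _ (logD y) tau) ?(ltW L0)//.
  ring.
have e1 : 1 <= expR 2 :> R by rewrite -expR0 ler_expR.
rewrite ler_wpM2l//; first by lra.
apply: ler_pM; rewrite ?sqr_ge0 ?powR_ge0//.
  by rewrite /sqD lerDr expR_ge0.
apply: ge0_ler_powR; rewrite ?nnegrE ?ln_ge0//.
- by lra.
- by rewrite lerDl sqr_ge0.
- by rewrite (le_trans e1)// /sqD lerDl sqr_ge0.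
- by rewrite /logD /sqD ler_ln ?posrE// ?lerD2r// ltr_wpDr ?sqr_ge0.
Qed.

Lemma log_weight_log tau y m : 0 < tau -> tau <= 1 -> 1 <= m ->
  ln (expR 1 + log_weight tau y ^+ 2 / m) <= 2 * logD y.
Proof.
move=> tau0 tau1 m1; have P0 := sqD_gt0 y.
have P2 : expR 1 * expR 1 <= sqD y.
  by rewrite -expRD (_ : 1 + 1 = 2)// /sqD lerDl sqr_ge0.
have e2 := expR1_ge2.
have -> : 2 * logD y = ln (sqD y ^+ 2) by rewrite lnXn// mulr_natl.
have q : 0 <= log_weight tau y ^+ 2 / m by rewrite divr_ge0 ?sqr_ge0//; lra.
rewrite ler_ln ?posrE//; last 2 first.
- by rewrite ltr_wpDr// expR_gt0.
- by rewrite exprn_gt0.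
have : log_weight tau y ^+ 2 / m <= sqD y.
  apply: le_trans (log_weight_sqr_le y tau0 tau1).
  have m0 : 0 < m by lra.
  by rewrite ler_pdivrMr// ler_peMr ?sqr_ge0.
have e2P : expR 1 * 2 <= expR 1 * expR 1 :> R by rewrite ler_pM2l// expR_gt0.
by nra.
Qed.

(** The derivative is L^(-(1 - tau) / 2) times y / sqrt(e^2 + y^2) times
    1 - (1 - tau) / L, and the last two factors have modulus at most 1. *)
Lemma log_weight_derive tau y : 0 < tau -> tau <= 1 -> exists l, is_derive y 1 (log_weight tau) l /\
  l ^+ 2 <= logD y `^ (tau - 1).
Proof.
move=> tau0 tau1.
have P0 := sqD_gt0 y; have L0 := logD_gt0 y; have L2 := logD_ge2 y.
have dP := is_derive_sqrD (expR 2) y.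
have dA := is_derive1_comp (is_derive1_powR 2^-1 P0) dP.
have dL := is_derive1_comp (is_derive1_ln P0) dP.
have dB := is_derive1_comp (g := logD) (is_derive1_powR (- ((1 - tau) / 2)) L0) dL.
have dH := is_deriveM dA dB.
eexists; split; first exact: dH.
rewrite /= /GRing.scale/= -/(sqD y) -/(logD y).
set r := sqD y `^ 2^-1; have r2 : r ^+ 2 = sqD y by exact: powR_half_sqr (ltW P0).
have r0 : 0 < r by exact: powR_gt0.
have -> : sqD y `^ (2^-1 - 1) = r^-1.
  by rewrite -powRN; congr (_ `^ _); lra.
set q := logD y `^ (- ((1 - tau) / 2)); have q2 : q ^+ 2 = logD y `^ (tau - 1).
  rewrite expr2 -powRD; last by rewrite (gt_eqF L0) implybT.
  by congr (_ `^ _); lra.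
have -> : logD y `^ (- ((1 - tau) / 2) - 1) = q / logD y.
  rewrite -[in RHS](@powR_inv1 _ (logD y)) ?ltW// -powRD//.
  by rewrite (gt_eqF L0) implybT.
rewrite -q2 -r2.
have -> : r * (- ((1 - tau) / 2) * (q / logD y) * ((r ^+ 2)^-1 * (2 * y))) +
   q * (2^-1 * r^-1 * (2 * y)) = q * ((y / r) * (1 - 2 * ((1 - tau) / 2) / logD y)).
  by field; rewrite !gt_eqF.
rewrite exprMn ler_piMr ?sqr_ge0// exprMn mulr_ile1 ?sqr_ge0//.
  rewrite expr_div_n ler_pdivrMr ?exprn_gt0// mul1r r2 /sqD lerDr expR_ge0//.
have hu : 0 <= 2 * ((1 - tau) / 2) / logD y by apply: divr_ge0; [lra|exact: ltW].
have hl : 2 * ((1 - tau) / 2) / logD y <= 1 by rewrite ler_pdivrMr//; lra.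
set w := _ / logD y in hu hl *.
nra.
Qed.

End real_inequalities.

(** * The defective F-Sobolev inequality *)

Section ereal_helpers.
Context {R : realType}.
Local Open Scope ereal_scope.

Lemma lee_affine_div (c a b : R) (x y : \bar R) : (0 < c)%R -> 0 <= y ->
  c%:E * x <= a%:E + b%:E * y -> x <= (a / c)%:E + (b / c)%:E * y.
Proof.
move=> c0 y0 h.
have -> : (a / c)%:E + (b / c)%:E * y = c^-1%:E * (a%:E + b%:E * y).
  rewrite muleDr//.
  by rewrite muleA -!EFinM ![(c^-1 * _)%R]mulrC.
have -> : x = c^-1%:E * (c%:E * x) by rewrite muleA -EFinM mulVf ?gt_eqF// mul1e.
by apply: lee_wpmul2l => //; rewrite lee_fin invr_ge0 ltW.
Qed.

Lemma lee_affine (a b a' b' : R) (y : \bar R) : 0 <= y -> (a <= a')%R -> (b <= b')%R ->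
  a%:E + b%:E * y <= a'%:E + b'%:E * y.
Proof. by move=> y0 aa bb; apply: leeD; rewrite ?lee_fin// lee_wpmul2r ?lee_fin. Qed.

Lemma lee_Zl_sum (c a b : R) (x y z : \bar R) : (0 <= c)%R -> (0 <= a)%R ->
  (0 <= b)%R -> 0 <= x -> 0 <= y -> z <= a%:E * x + b%:E * y ->
  c%:E * z <= (c * a)%:E * x + (c * b)%:E * y.
Proof.
move=> c0 a0 b0 x0 y0 h; rewrite !EFinM -!muleA -ge0_muleDr ?mule_ge0 ?lee_fin//.
by apply: lee_wpmul2l; rewrite ?lee_fin.
Qed.

End ereal_helpers.

Section defective.
Context {R : realType} (d : nat) (mu : probability 'rV[R]_d R).
Implicit Types f g h : 'rV[R]_d -> R.
Local Notation meas f := (measurable_fun [set: 'rV[R]_d] f).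
Local Notation I f := (\int[mu]_x (f%R x)%:E)%E.
Local Notation L1 f := (mu.-integrable [set: 'rV[R]_d] (EFin \o f)).

Definition dirichlet f : \bar R := I (fun x => norm2 (grad f x) ^+ 2).

Lemma dirichlet_ge0 f : (0 <= dirichlet f)%E.
Proof. by apply: int_ge0 => x; exact: sqr_ge0. Qed.

Lemma dirichlet_Z c f : c != 0 -> smooth f ->
  dirichlet (fun x => c * f x) = ((c ^+ 2)%:E * dirichlet f)%E.
Proof.
move=> _ Cf; rewrite -int_Zl ?sqr_ge0//; last first.
- by move=> x; exact: sqr_ge0.
- by apply: measurable_funX; exact: measurable_norm2_grad.
apply: eq_integral => x _; congr EFin.
by rewrite gradZ// norm2Z exprMn -normrX ger0_norm ?sqr_ge0.
Qed.

Lemma dirichlet_B c f : smooth f -> dirichlet (fun x => f x - c) = dirichlet f.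
Proof. by move=> Cf; apply: eq_integral => x _; rewrite gradB. Qed.

Lemma ineq_I_pos tau : ineq_I mu tau -> exists B C : R, [/\ 0 <= B, 1 <= C &
  forall f, smoothL2 mu f ->
    (Ent mu (fun x => (f x ^+ 2)%R) <= (B * \int[mu]_x (f x ^+ 2))%:E
        + C%:E * I (fun x => norm2 (grad f x) ^+ 2 *
             (ln (expR 1 + f x ^+ 2 / (\int[mu]_y (f y ^+ 2))%R)) `^ (1 - tau)))%E].
Proof.
move=> [B [C hI]]; exists (Order.max B 0), (Order.max C 1); split.
- by rewrite le_max lexx orbT.
- by rewrite le_max lexx orbT.
move=> f Lf; apply: le_trans (hI f Lf) _; apply: leeD.
  rewrite lee_fin ler_wpM2r ?le_max ?lexx//.
  by apply: Rintegral_ge0 => x _; exact: sqr_ge0.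
apply: lee_wpmul2r; last by rewrite lee_fin le_max lexx.
by apply: int_ge0 => x; rewrite mulr_ge0 ?sqr_ge0 ?powR_ge0.
Qed.

Lemma measurable_ln_comp f : meas f -> meas (fun x => ln (f x)).
Proof. by move=> mf; apply: (measurableT_comp (@measurable_ln R)). Qed.

Lemma measurable_powR_comp f a : meas f -> meas (fun x => f x `^ a).
Proof. by move=> mf; apply: (measurableT_comp (@measurable_powR R a)). Qed.

Lemma smoothL2_sqr_measurable f : smoothL2 mu f -> meas (fun x => f x ^+ 2).
Proof. by move=> [Cf _]; apply: measurable_funX; exact: smooth_measurable. Qed.

Lemma log_weight_smooth tau f : smooth f -> smooth (fun x => log_weight tau (f x)).
Proof.
move=> Cf; have CP : smooth (fun x => sqD (f x)).
  by apply: smoothD; [exact: smooth_cst|exact: smoothX].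
apply: smoothM; first by apply: smooth_powR => // x; exact: sqD_gt0.
apply: smooth_powR => [x|]; first exact: logD_gt0.
by apply: smooth_ln => // x; exact: sqD_gt0.
Qed.

Definition logpow (tau t : R) : R := ln (1 + t) `^ tau.

Lemma measurable_logpow tau : measurable_fun [set: R] (logpow tau).
Proof.
apply: (measurableT_comp (@measurable_powR R tau)).
apply: (measurableT_comp (@measurable_ln R)).
exact: measurable_funD.
Qed.

(** I(tau) is applied to f = [log_weight tau g]: the weight
    ln^(1 - tau) (e + f^2 / m) is at most (2 L)^(1 - tau) with L = [logD g], and
    |grad f|^2 <= L^(tau - 1) |grad g|^2. *)
Lemma defective_F tau : 0 < tau -> tau <= 1 -> ineq_I mu tau ->
  exists K : R, 0 <= K /\ forall g, smoothL2 mu g -> \int[mu]_x (g x ^+ 2) = 1 ->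
    (I (fun x => g x ^+ 2 * logpow tau (g x ^+ 2)) <= K%:E + K%:E * dirichlet g)%E.
Proof.
move=> tau0 tau1 /ineq_I_pos[B [C [B0 C1 hI]]].
pose M : R := expR 2 + 1.
have M1 : 1 <= M by rewrite lerDr expR_ge0.
have K10 : 0 <= (B * M + M * M) / tau by apply: divr_ge0; [nra|exact: ltW].
have K20 : 0 <= (C * 2) / tau by apply: divr_ge0; [lra|exact: ltW].
exists ((B * M + M * M) / tau + C * 2 / tau); split; first exact: addr_ge0.
move=> g Lg g1; have [Cg Ig] := Lg.
apply: (@le_trans _ _ (((B * M + M * M) / tau)%:E + (C * 2 / tau)%:E * dirichlet g)%E);
  last by apply: lee_affine; [exact: dirichlet_ge0|lra..].
apply: lee_affine_div => //; first exact: dirichlet_ge0.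
pose f x := log_weight tau (g x).
have Lf : smoothL2 mu f.
  apply: (@L2_bound _ _ mu g f (expR 2) 1) => //; first exact: log_weight_smooth.
  by move=> x; rewrite mul1r; exact: log_weight_sqr_le.
have [Cf If] := Lf.
set m := \int[mu]_x (f x ^+ 2).
have m1 : 1 <= m.
  have -> : 1 = \int[mu]_x (1 + 0 * g x ^+ 2) by rewrite Rint_affine// mul0r addr0.
  apply: le_Rintegral => //; first exact: L1_affine.
  by move=> x _; rewrite mul0r addr0; exact: log_weight_sqr_ge1.
have mM : m <= M.
  have -> : M = \int[mu]_x (expR 2 + 1 * g x ^+ 2) by rewrite Rint_affine// g1 mulr1.
  apply: le_Rintegral => //; first exact: L1_affine.
  by move=> x _; rewrite mul1r; exact: log_weight_sqr_le.
have mf2 := smoothL2_sqr_measurable Lf; have mg2 := smoothL2_sqr_measurable Lg.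
have mgP : meas (fun x => g x ^+ 2 * logpow tau (g x ^+ 2)).
  by apply: measurable_funM => //; apply: (measurableT_comp (measurable_logpow tau)).
have g0 x : 0 <= g x ^+ 2 * logpow tau (g x ^+ 2).
  by rewrite mulr_ge0 ?sqr_ge0 ?powR_ge0.
rewrite -int_Zl ?(ltW tau0)//.
have Lj : L1 (fun x => 0 + ln m * f x ^+ 2) by exact: L1_affine.
have step : (I (fun x => tau * (g x ^+ 2 * logpow tau (g x ^+ 2))) <=
    Ent mu (fun x => (f x ^+ 2)%R) + I (fun x => 0 + ln m * f x ^+ 2))%E.
  apply: int_lower => //.
  - exact: measurable_funM.
  - by move=> x; rewrite mulr_ge0 ?(ltW tau0).
  - apply: measurable_funM => //; apply: measurable_ln_comp.
    exact: measurable_funM.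
  - move=> x; apply: le_trans (log_weight_entropy _ tau0 tau1) _.
    have f2 : 0 < f x ^+ 2 by apply: lt_le_trans (log_weight_sqr_ge1 _ tau0 tau1).
    rewrite -/(f x) -/m ln_div ?posrE//; last by lra.
    by rewrite add0r; lra.
apply: le_trans step _; rewrite (int_L1 Lj) Rint_affine// -/m add0r.
have lnm : ln m * m <= M * M.
  rewrite ler_pM//; [exact: ln_ge0|lra|].
  by apply: le_trans mM; apply/ltW/ln_sublinear; lra.
suff E1 : (Ent mu (fun x => (f x ^+ 2)%R) <=
    (B * M)%:E + (C * 2)%:E * dirichlet g)%E.
  apply: le_trans (leeD E1 (_ : ((ln m * m)%:E <= (M * M)%:E)%E)) _.
    by rewrite lee_fin.
  by rewrite addeAC -EFinD.
apply: le_trans (hI _ Lf) _; rewrite -/m; apply: leeD.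
  by rewrite lee_fin ler_wpM2l.
rewrite EFinM -muleA; apply: lee_wpmul2l; first by rewrite lee_fin; lra.
rewrite -int_Zl//; last 2 first.
- by apply: measurable_funX; exact: measurable_norm2_grad.
- by move=> x; exact: sqr_ge0.
apply: le_int_ge0 => x; first by rewrite mulr_ge0 ?sqr_ge0 ?powR_ge0.
have [l [dl l2]] := log_weight_derive (g x) tau0 tau1.
rewrite (@grad_comp _ _ g (log_weight tau) l)// norm2Z exprMn -normrX ger0_norm ?sqr_ge0//.
have L2 := logD_ge2 (g x); have L0 := logD_gt0 (g x).
set N := norm2 _ ^+ 2; have N0 : 0 <= N by exact: sqr_ge0.
rewrite [l ^+ 2 * N]mulrC -mulrA [2 * N]mulrC ler_wpM2l//.
have pos : 0 <= ln (expR 1 + f x ^+ 2 / m) `^ (1 - tau) by exact: powR_ge0.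
apply: (@le_trans _ _ (logD (g x) `^ (tau - 1) * (2 * logD (g x)) `^ (1 - tau))).
  apply: ler_pM; rewrite ?sqr_ge0//; apply: ge0_ler_powR.
  - lra.
  - rewrite nnegrE; apply: ln_ge0; have e2 := @expR1_ge2 R.
    have : 0 <= f x ^+ 2 / m by rewrite divr_ge0 ?sqr_ge0//; lra.
    lra.
  - by rewrite nnegrE; lra.
  - exact: log_weight_log.
rewrite powRM ?(ltW L0)// mulrCA -powRD; last by rewrite (gt_eqF L0) implybT.
have -> : tau - 1 + (1 - tau) = 0 by lra.
rewrite powRr0 mulr1 ler1_powR//; lra.
Qed.

End defective.

(** * Truncation and logarithmic gradients *)

Section young.
Context {R : realType}.
Implicit Types x L tau eps t k : R.

(** Either x^2 <= eps L^tau, and the first term is large enough, or L is at most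
    a power of x^2 / eps, and the second one is. *)
Lemma young_log tau x L eps : 0 < tau -> tau <= 1 -> 0 <= x -> 1 <= L -> 0 < eps ->
  x ^+ 2 * L `^ (1 - tau) <=
  eps * L + eps^-1 `^ ((1 - tau) / tau) * x `^ (2 / tau).
Proof.
move=> tau0 tau1 x0 L1 eps0; have L0 : 0 < L by lra.
have [le|/ltW ge] := leP (x ^+ 2) (eps * L `^ tau).
  apply: (@le_trans _ _ (eps * L)); last by rewrite lerDl mulr_ge0 ?powR_ge0.
  have -> : eps * L = eps * L `^ tau * L `^ (1 - tau).
    rewrite -mulrA -powRD; last by rewrite (gt_eqF L0) implybT.
    by rewrite (_ : tau + (1 - tau) = 1) ?powRr1 ?(ltW L0)//; lra.
  by rewrite ler_wpM2r ?powR_ge0.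
apply: (@le_trans _ _ (eps^-1 `^ ((1 - tau) / tau) * x `^ (2 / tau))); last first.
  by rewrite lerDr mulr_ge0 ?ltW.
have -> : x `^ (2 / tau) = x ^+ 2 * (x ^+ 2) `^ ((1 - tau) / tau).
  have -> : (1 - tau) / tau = tau^-1 - 1 by field; rewrite gt_eqF.
  rewrite mulr_powRB1 ?sqr_ge0 ?invr_gt0//.
  by rewrite powRrM powR_mulrn.
rewrite mulrCA ler_wpM2l ?sqr_ge0// -powRM ?sqr_ge0 ?invr_ge0 ?(ltW eps0)//.
have -> : L `^ (1 - tau) = (L `^ tau) `^ ((1 - tau) / tau).
  by rewrite -powRrM; congr (_ `^ _); field; rewrite gt_eqF.
apply: ge0_ler_powR; rewrite ?nnegrE ?powR_ge0//.
- by rewrite divr_ge0 ?(ltW tau0)//; lra.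
- by rewrite mulr_ge0 ?sqr_ge0 ?invr_ge0 ?(ltW eps0).
- by rewrite ler_pdivlMl.
Qed.

(** This is t^2 / (1 + k t^2), which is at most 1 / k and increases to t^2 as k
    decreases to 0; the real power is the form that [smooth_powR] handles. *)
Definition trunc k t := t ^+ 2 * (1 + k * t ^+ 2) `^ (-1).
(** The constant 1 keeps the root smooth and bounded below, so that the mass of
    its square stays between 1 and 2. *)
Definition trunc_root k t := (1 + trunc k t) `^ 2^-1.

Lemma truncD_ge1 k t : 0 < k -> 1 <= 1 + k * t ^+ 2.
Proof. by move=> k0; rewrite lerDl mulr_ge0 ?sqr_ge0 ?ltW. Qed.

Lemma truncE k t : 0 < k -> trunc k t = t ^+ 2 / (1 + k * t ^+ 2).
Proof. by move=> k0; rewrite /trunc powR_inv1//; have := truncD_ge1 t k0; lra. Qed.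

Lemma trunc_ge0 k t : 0 <= trunc k t.
Proof. by rewrite mulr_ge0 ?sqr_ge0 ?powR_ge0. Qed.

Lemma trunc_le k t : 0 < k -> trunc k t <= t ^+ 2.
Proof.
move=> k0; have D1 := truncD_ge1 t k0.
by rewrite truncE// ler_pdivrMr ?ler_peMr ?sqr_ge0//; lra.
Qed.

Lemma trunc_le_inv k t : 0 < k -> trunc k t <= k^-1.
Proof.
move=> k0; have D1 := truncD_ge1 t k0.
have D0 : 0 < 1 + k * t ^+ 2 by lra.
by rewrite truncE// ler_pdivrMr// mulrDr mulKf ?gt_eqF// mulr1 lerDr invr_ge0 ltW.
Qed.

Lemma trunc_root_sqr k t : trunc_root k t ^+ 2 = 1 + trunc k t.
Proof. by rewrite powR_half_sqr// addr_ge0// trunc_ge0. Qed.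

Lemma trunc_root_gt0 k t : 0 < trunc_root k t.
Proof. by rewrite powR_gt0// ltr_pwDl// trunc_ge0. Qed.

Lemma trunc_root_derive k t : 0 < k ->
  is_derive t 1 (trunc_root k) (t / (trunc_root k t * (1 + k * t ^+ 2) ^+ 2)).
Proof.
move=> k0; have D1 := truncD_ge1 t k0.
have D0 : 0 < 1 + k * t ^+ 2 by lra.
have A0 : 0 < 1 + trunc k t by rewrite ltr_pwDl// trunc_ge0.
have dS : is_derive t 1 (fun y : R => y ^+ 2) (2 * t).
  by apply: is_derive_eq; rewrite /GRing.scale/=; ring.
have dD : is_derive t 1 (fun y : R => 1 + k * y ^+ 2) (k * (2 * t)).
  by apply: is_derive_eq; rewrite /GRing.scale/=; ring.
have dV := is_derive1_comp (g := fun y : R => 1 + k * y ^+ 2) (is_derive1_powR (-1) D0) dD.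
have dT := is_deriveM dS dV.
have dA : is_derive t 1 (fun y : R => 1 + trunc k y)
    (t ^+ 2 * (-1 * (1 + k * t ^+ 2) `^ (-1 - 1) * (k * (2 * t))) +
     (1 + k * t ^+ 2) `^ (-1) * (2 * t)).
  have := is_deriveD (is_derive_cst (1:R) t (1:R)) dT.
  by rewrite add0r.
have dR := is_derive1_comp (g := fun y => 1 + trunc k y) (is_derive1_powR 2^-1 A0) dA.
apply: (is_derive_eq dR); rewrite -/(trunc_root k t).
have -> : (1 + trunc k t) `^ (2^-1 - 1) = (trunc_root k t)^-1.
  by rewrite -powRN; congr (_ `^ _); lra.
have -> : (1 + k * t ^+ 2) `^ (-1 - 1) = ((1 + k * t ^+ 2) ^+ 2)^-1.
  rewrite powRD; last by rewrite (gt_eqF D0) implybT.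
  by rewrite powR_inv1 ?ltW// expr2 invfM.
rewrite powR_inv1 ?(ltW D0)//.
by field; rewrite !gt_eqF// trunc_root_gt0.
Qed.

Lemma ln_add_e (y : R) : 2^-1 <= y -> ln (expR 1 + y) <= ln y + 3.
Proof.
move=> y2; have e2 := @expR1_ge2 R; have y0 : 0 < y by lra.
have -> : 3 = ln (expR 3 : R) by rewrite expRK.
rewrite -lnM ?posrE ?expR_gt0// ler_ln ?posrE ?mulr_gt0 ?expR_gt0//; last first.
  by rewrite addr_gt0 ?expR_gt0.
have -> : expR 3 = expR 1 * expR 1 * expR 1 :> R.
  by rewrite -!expRD; congr expR; lra.
have e3 : 4 * expR 1 <= expR 1 * expR 1 * expR 1 :> R by nra.
have ye : y * (4 * expR 1) <= y * (expR 1 * expR 1 * expR 1) by rewrite ler_pM2l.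
nra.
Qed.

Lemma ln_e_ge1 (y : R) : 0 <= y -> 1 <= ln (expR 1 + y).
Proof.
move=> y0; rewrite -[leLHS](@expRK R) ler_ln ?posrE ?expR_gt0 ?lerDl//.
by rewrite ltr_wpDr ?expR_gt0.
Qed.

(** Dividing the argument by 2 costs at most a factor 2 in the logarithm, since
    (e + y / 2)^2 >= e + y. *)
Lemma ln_e_half (y : R) : 0 <= y -> ln (expR 1 + y) <= 2 * ln (expR 1 + y / 2).
Proof.
move=> y0; have e2 := @expR1_ge2 R.
have e0 : 0 < expR 1 + y / 2 by lra.
have -> : 2 * ln (expR 1 + y / 2) = ln ((expR 1 + y / 2) ^+ 2).
  by rewrite lnXn// mulr_natl.
rewrite ler_ln ?posrE ?exprn_gt0//; last by lra.
nra.
Qed.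

End young.

Section log_gradient.
Context {R : realType} (d : nat) (mu : probability 'rV[R]_d R).
Implicit Types f g h : 'rV[R]_d -> R.
Local Notation meas f := (measurable_fun [set: 'rV[R]_d] f).
Local Notation I f := (\int[mu]_x (f%R x)%:E)%E.
Local Notation L1 f := (mu.-integrable [set: 'rV[R]_d] (EFin \o f)).

(** |grad f| / |f|, with value 0 at the zeros of f. *)
Definition lgrad f x : R := norm2 ((f x)^-1 *: grad f x).

Definition lenergy (p : R) f : \bar R := I (fun x => f x ^+ 2 * lgrad f x `^ p).

Lemma lgradE f x : lgrad f x = `|f x|^-1 * norm2 (grad f x).
Proof. by rewrite /lgrad norm2Z normfV. Qed.

Lemma lgrad_ge0 f x : 0 <= lgrad f x.
Proof. exact: norm2_ge0. Qed.

Lemma measurable_lgrad f : smooth f -> meas (lgrad f).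
Proof.
move=> Cf; rewrite (_ : lgrad f = fun x => `|f x|^-1 * norm2 (grad f x)); last first.
  by apply/funext => x; rewrite lgradE.
apply: measurable_funM; last exact: measurable_norm2_grad.
apply: measurable_inv_fun; apply: (measurableT_comp (@normr_measurable R _)) => //.
exact: smooth_measurable.
Qed.

Lemma measurable_lenergy p f : smooth f -> meas (fun x => f x ^+ 2 * lgrad f x `^ p).
Proof.
move=> Cf; apply: measurable_funM.
  by apply: measurable_funX; exact: smooth_measurable.
by apply: measurable_powR_comp; exact: measurable_lgrad.
Qed.

Lemma lenergy_ge0 p f : (0 <= lenergy p f)%E.
Proof. by apply: int_ge0 => x; rewrite mulr_ge0 ?sqr_ge0 ?powR_ge0. Qed.

Lemma lgradZ c f x : c != 0 -> smooth f -> lgrad (fun y => c * f y) x = lgrad f x.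
Proof.
move=> c0 Cf; rewrite !lgradE gradZ// norm2Z normrM invfM mulrACA.
by rewrite mulVf ?normr_eq0// mul1r.
Qed.

Lemma lenergy_Z p c f : c != 0 -> smooth f ->
  lenergy p (fun x => c * f x) = ((c ^+ 2)%:E * lenergy p f)%E.
Proof.
move=> c0 Cf; rewrite -int_Zl ?sqr_ge0//; last first.
- by move=> x; rewrite mulr_ge0 ?sqr_ge0 ?powR_ge0.
- exact: measurable_lenergy.
by apply: eq_integral => x _; rewrite lgradZ// exprMn mulrA.
Qed.

(** By the chain rule, [lgrad] of H o f is the product of [lgrad f] and
    |l f / H(f)|.  At a zero of f, where [lgrad f] = 0, the gradient of H o f has
    to vanish too, hence the condition on l. *)
Lemma lgrad_comp_le (p c : R) f (H : R -> R) (l : R) x : smooth f -> p != 0 -> 0 <= c ->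
  is_derive (f x) 1 H l -> (f x = 0 -> l = 0) ->
  H (f x) ^+ 2 * `|l * f x / H (f x)| `^ p <= c * f x ^+ 2 ->
  H (f x) ^+ 2 * lgrad (fun y => H (f y)) x `^ p <=
    c * (f x ^+ 2 * lgrad f x `^ p).
Proof.
move=> Cf p0 c0 dH l0 Hl; rewrite !lgradE (grad_comp Cf dH) norm2Z.
have [f0|fN0] := eqVneq (f x) 0.
  rewrite (l0 f0) normr0 mul0r mulr0 powR0// mulr0.
  by rewrite mulr_ge0// mulr_ge0 ?sqr_ge0 ?powR_ge0.
have -> : `|H (f x)|^-1 * (`|l| * norm2 (grad f x)) =
    `|l * f x / H (f x)| * (`|f x|^-1 * norm2 (grad f x)).
  rewrite !normrM normfV; have := fN0; rewrite -normr_eq0 => h.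
  rewrite -[in LHS](mul1r (norm2 _)) -[in LHS](mulfV h); ring.
rewrite powRM// ?mulr_ge0 ?invr_ge0 ?norm2_ge0// mulrA [c * _]mulrA.
by rewrite ler_wpM2r ?powR_ge0.
Qed.

End log_gradient.

(** * The defective modified logarithmic Sobolev inequality *)

Section defective_log.
Context {R : realType} (d : nat) (mu : probability 'rV[R]_d R).
Implicit Types f g h : 'rV[R]_d -> R.
Local Notation meas f := (measurable_fun [set: 'rV[R]_d] f).
Local Notation I f := (\int[mu]_x (f%R x)%:E)%E.
Local Notation L1 f := (mu.-integrable [set: 'rV[R]_d] (EFin \o f)).

Lemma absorb_half (a b : R) (x y : \bar R) : (0 <= x)%E -> (x < +oo)%E -> (0 <= y)%E ->
  0 <= b -> (x <= a%:E + b%:E * y + 2^-1%:E * x)%E -> (x <= (2 * a)%:E + (2 * b)%:E * y)%E.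
Proof.
move=> x0 xoo y0 b0 h.
have [yoo|] := eqVneq y +oo%E; last first.
  move=> yN.
  have yf : y \is a fin_num by rewrite ge0_fin_numE// ltey.
  have xf : x \is a fin_num by rewrite ge0_fin_numE.
  move: h; rewrite -(fineK yf) -(fineK xf) -!EFinM -!EFinD !lee_fin; lra.
move: h; rewrite yoo; move: b0; rewrite le_eqVlt => /predU1P[<-|b0].
  rewrite mulr0 !mul0e !adde0.
  have xf : x \is a fin_num by rewrite ge0_fin_numE.
  rewrite -(fineK xf) -!EFinM -!EFinD !lee_fin; lra.
by move=> _; rewrite gt0_muley ?lte_fin ?mulr_gt0// addey// leey.
Qed.

Lemma trunc_smooth k f : 0 < k -> smooth f -> smooth (fun x => trunc_root k (f x)).
Proof.
move=> k0 Cf; apply: smooth_powR => [x|].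
  by rewrite ltr_pwDl// trunc_ge0.
apply: smoothD; first exact: smooth_cst.
apply: smoothM; first exact: smoothX.
apply: smooth_powR => [x|].
  by have := truncD_ge1 (f x) k0; lra.
apply: smoothD; first exact: smooth_cst.
by apply: smoothM; [exact: smooth_cst|exact: smoothX].
Qed.

(** Truncation multiplies [lgrad f] by r = t^2 / (h^2 D^2), where D = 1 + k t^2;
    since r <= 1 one has r^p <= r, and h^2 r = t^2 / D^2 <= t^2. *)
Lemma trunc_root_energy k p f x : smooth f -> 0 < k -> 1 <= p ->
  trunc_root k (f x) ^+ 2 * lgrad (fun y => trunc_root k (f y)) x `^ p <=
  f x ^+ 2 * lgrad f x `^ p.
Proof.
move=> Cf k0 p1; rewrite -[leRHS]mul1r.
set t := f x; set h := trunc_root k t.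
have D1 := truncD_ge1 t k0; set D := 1 + k * t ^+ 2 in D1.
have h0 : 0 < h := trunc_root_gt0 k t.
have D0 : 0 < D by lra.
apply: (lgrad_comp_le Cf _ _ (trunc_root_derive t k0)) => //.
- by rewrite gt_eqF//; lra.
- by rewrite -/t => ->; rewrite mul0r.
rewrite -/t -/h -/D mul1r.
set r := _ * t / h.
have rE : r = t ^+ 2 / (h ^+ 2 * D ^+ 2) by rewrite /r; field; rewrite !gt_eqF.
have r0 : 0 <= r by rewrite rE divr_ge0 ?sqr_ge0// mulr_ge0 ?sqr_ge0.
have D2 : 1 <= D ^+ 2 by rewrite expr_ge1// ltW.
have tD : t ^+ 2 <= h ^+ 2 * D ^+ 2.
  apply: (@le_trans _ _ (h ^+ 2 * D)).
    rewrite trunc_root_sqr truncE// mulrDl mul1r divfK ?gt_eqF//.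
    by rewrite lerDr ltW.
  by rewrite ler_pM2l ?exprn_gt0// ler_eXnr.
have r1 : r <= 1 by rewrite rE ler_pdivrMr ?mul1r// mulr_gt0 ?exprn_gt0.
rewrite ger0_norm//; apply: (@le_trans _ _ (h ^+ 2 * r)).
  rewrite ler_wpM2l ?sqr_ge0//.
  move: r0; rewrite le_eqVlt => /predU1P[<-|r0]; first by rewrite powR0// gt_eqF//; lra.
  by apply: ge1r_powR => //; rewrite r0.
have -> : h ^+ 2 * r = t ^+ 2 / D ^+ 2 by rewrite rE; field; rewrite !gt_eqF.
by rewrite ler_pdivrMr ?exprn_gt0// ler_peMr ?sqr_ge0.
Qed.

(** The function h = [trunc_root k f] is bounded, so the integral of
    h^2 ln(e + h^2 / m) is finite, and the half of it that Young's inequality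
    leaves on the right-hand side can be absorbed.  What matters is that the
    constants do not depend on k. *)
Lemma trunc_root_defective tau B C k f : 0 < tau -> tau <= 1 -> 0 <= B -> 1 <= C -> 0 < k ->
  (forall f, smoothL2 mu f ->
    (Ent mu (fun x => (f x ^+ 2)%R) <= (B * \int[mu]_x (f x ^+ 2))%:E
        + C%:E * I (fun x => norm2 (grad f x) ^+ 2 *
             (ln (expR 1 + f x ^+ 2 / (\int[mu]_y (f y ^+ 2))%R)) `^ (1 - tau)))%E) ->
  smoothL2 mu f -> \int[mu]_x (f x ^+ 2) = 1 ->
  (I (fun x => trunc k (f x) * ln (expR 1 + trunc k (f x))) <=
    (4 * (2 * B + 6))%:E + (4 * (C * (2 * C) `^ ((1 - tau) / tau)))%:E * lenergy mu (2 / tau) f)%E.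
Proof.
move=> tau0 tau1 B0 C1 k0 hI Lf f1; have [Cf If] := Lf.
have p1 : 1 <= 2 / tau by rewrite ler_pdivlMr//; lra.
set Y := (2 * C) `^ _; have Y0 : 0 <= Y by exact: powR_ge0.
pose h x := trunc_root k (f x).
have h2E x : h x ^+ 2 = 1 + trunc k (f x) by exact: trunc_root_sqr.
have h0 x : 0 < h x by exact: trunc_root_gt0.
have h21 x : 1 <= h x ^+ 2 by rewrite h2E lerDl trunc_ge0.
have Ch : smooth h by exact: trunc_smooth.
have Lh : smoothL2 mu h.
  apply: (@L2_bound _ _ mu f h 1 1) => // x.
  by rewrite h2E mul1r lerD2l trunc_le.
have [_ Ih] := Lh.
set m := \int[mu]_x (h x ^+ 2).
have m1 : 1 <= m.
  have -> : 1 = \int[mu]_x (1 + 0 * f x ^+ 2) by rewrite Rint_affine// mul0r addr0.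
  apply: le_Rintegral => //; first exact: L1_affine.
  by move=> x _; rewrite mul0r addr0.
have m2 : m <= 2.
  have -> : 2 = \int[mu]_x (1 + 1 * f x ^+ 2) by rewrite Rint_affine// f1 mulr1.
  apply: le_Rintegral => //; first exact: L1_affine.
  by move=> x _; rewrite mul1r h2E lerD2l trunc_le.
have m0 : 0 < m by lra.
have hm0 x : 0 <= h x ^+ 2 / m by rewrite divr_ge0 ?sqr_ge0// ltW.
pose L x := ln (expR 1 + h x ^+ 2 / m).
have L1' x : 1 <= L x by exact: ln_e_ge1.
have mh2 : meas (fun x => h x ^+ 2) by exact: smoothL2_sqr_measurable Lh.
have mhm : meas (fun x => h x ^+ 2 / m) by exact: measurable_funM.
have mL : meas L by apply: measurable_ln_comp; exact: measurable_funD.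
have mhL : meas (fun x => h x ^+ 2 * L x) by exact: measurable_funM.
have hL0 x : 0 <= h x ^+ 2 * L x by rewrite mulr_ge0 ?sqr_ge0//; have := L1' x; lra.
have mt : meas (fun x => trunc k (f x)).
  rewrite (_ : (fun _ => _) = (fun x => h x ^+ 2 - 1)); last first.
    by apply/funext => x; rewrite h2E addrAC subrr add0r.
  exact: measurable_funB.
have Jfin : (I (fun x => h x ^+ 2 * L x) < +oo)%E.
  (* h^2 <= 1 + 1 / k, so the integrand is bounded. *)
  pose c := (1 + k^-1) * ln (expR 1 + (1 + k^-1)).
  apply: (@le_lt_trans _ _ (I (fun=> c))); last by rewrite (int_L1 (L1_cst mu c)) ltry.
  apply: le_int => // x.
  have hk : h x ^+ 2 <= 1 + k^-1 by rewrite h2E lerD2l trunc_le_inv.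
  apply: ler_pM; rewrite ?sqr_ge0//; first by have := L1' x; lra.
  have hk' : h x ^+ 2 / m <= 1 + k^-1.
    by apply: le_trans hk; rewrite ler_pdivrMr// ler_peMr ?sqr_ge0.
  rewrite ler_ln ?posrE ?lerD2l// ltr_wpDr ?expR_gt0//.
  by rewrite (le_trans (hm0 x)).
have step1 : (I (fun x => h x ^+ 2 * L x) <=
    Ent mu (fun x => (h x ^+ 2)%R) + I (fun x => 0 + 3 * h x ^+ 2))%E.
  apply: int_lower => //.
  - by apply: measurable_funM => //; exact: measurable_ln_comp.
  - exact: L1_affine.
  - move=> x; rewrite -/m add0r.
    have : L x <= ln (h x ^+ 2 / m) + 3.
      by apply: ln_add_e; rewrite ler_pdivlMr//; have := h21 x; lra.
    by have := h21 x; nra.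
have step2 : (I (fun x => norm2 (grad h x) ^+ 2 * L x `^ (1 - tau)) <=
    (2 * C)^-1%:E * I (fun x => h x ^+ 2 * L x) + Y%:E * lenergy mu (2 / tau) f)%E.
  have eps0 : 0 < (2 * C)^-1 by rewrite invr_gt0; lra.
  have mE := measurable_lenergy (2 / tau) Cf.
  have nE x : 0 <= f x ^+ 2 * lgrad f x `^ (2 / tau).
    by rewrite mulr_ge0 ?sqr_ge0 ?powR_ge0.
  rewrite /lenergy -(int_Zl mu mhL (ltW eps0) hL0) -(int_Zl mu mE Y0 nE).
  rewrite -int_D; first last.
  - by move=> x; rewrite mulr_ge0.
  - by move=> x; rewrite mulr_ge0// ltW.
  - exact: measurable_funM.
  - exact: measurable_funM.
  apply: le_int_ge0 => x; first by rewrite mulr_ge0 ?sqr_ge0 ?powR_ge0.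
  have -> : norm2 (grad h x) ^+ 2 = h x ^+ 2 * lgrad h x ^+ 2.
    by rewrite -exprMn lgradE gtr0_norm// mulrA mulfV ?gt_eqF// mul1r.
  rewrite -mulrA.
  have yg := young_log tau0 tau1 (lgrad_ge0 h x) (L1' x) eps0.
  apply: (le_trans (ler_wpM2l (sqr_ge0 (h x)) yg)).
  have te := ler_wpM2l Y0 (trunc_root_energy (p := 2 / tau) x Cf k0 p1).
  rewrite invrK -/Y; rewrite -/(h x) in te.
  set a := (2 * C)^-1; set H := h x ^+ 2 in te *.
  rewrite [X in X <= _](_ : _ = a * (H * L x) + Y * (H * lgrad h x `^ (2 / tau))).
    by rewrite lerD2l.
  by rewrite mulrDr; congr (_ + _); exact: mulrCA.
have J0 := int_ge0 mu hL0; have E0 := lenergy_ge0 mu (2 / tau) f.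
set J := I (fun x => h x ^+ 2 * L x) in Jfin step1 step2 J0.
set E := lenergy _ _ _ in step2 E0 *.
have key : (J <= (2 * B + 6)%:E + (C * Y)%:E * E + 2^-1%:E * J)%E.
  apply: le_trans step1 _.
  have -> : I (fun x => 0 + 3 * h x ^+ 2) = (3 * m)%:E.
    by rewrite (int_L1 (L1_affine 0 3 Ih)) Rint_affine// add0r.
  have hh := hI _ Lh; rewrite -/m in hh.
  have h3 : (C%:E * I (fun x => norm2 (grad h x) ^+ 2 * L x `^ (1 - tau)) <=
      2^-1%:E * J + (C * Y)%:E * E)%E.
    have C0 : 0 <= C by lra.
    have V0 : 0 <= (2 * C)^-1 by rewrite invr_ge0 mulr_ge0.
    have -> : 2^-1 = C * (2 * C)^-1 by field; lra.
    exact: (lee_Zl_sum C0 V0 Y0 J0 E0 step2).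
  have h4 : ((B * m)%:E + (3 * m)%:E <= (2 * B + 6)%:E)%E.
    by rewrite -EFinD lee_fin; nra.
  apply: (@le_trans _ _ (((B * m)%:E + (2^-1%:E * J + (C * Y)%:E * E)) + (3 * m)%:E)%E).
    by apply: leeD => //; apply: (le_trans hh); apply: leeD.
  rewrite addeAC; apply: (le_trans (leeD h4 (lexx _))).
  by rewrite -addeA [X in (_ <= _ + X)%E]addeC.
have CY0 : 0 <= C * Y by rewrite mulr_ge0//; lra.
have := absorb_half J0 Jfin E0 CY0 key => Jle.
apply: (@le_trans _ _ (2%:E * J)%E).
  rewrite -int_Zl//; apply: le_int_ge0 => x.
    rewrite mulr_ge0 ?trunc_ge0//; have := ln_e_ge1 (trunc_ge0 k (f x)); lra.
  have q0 := trunc_ge0 k (f x).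
  rewrite mulrCA; apply: ler_pM => //.
  - by have := ln_e_ge1 q0; lra.
  - by rewrite h2E lerDr.
  - apply: le_trans (ln_e_half q0) _; rewrite ler_pM2l//.
    have q2 : 0 <= trunc k (f x) / 2 by rewrite divr_ge0.
    rewrite ler_ln ?posrE ?ltr_wpDr ?expR_gt0//.
    rewrite lerD2l h2E ler_pdivlMr// mulrAC ler_pdivrMr//; nra.
have two0 : (0 <= 2%:E :> \bar R)%E by rewrite lee_fin.
apply: (le_trans (lee_wpmul2l two0 Jle)).
rewrite ge0_muleDr; last 2 first.
- by rewrite lee_fin; lra.
- by rewrite mule_ge0// lee_fin mulr_ge0.
by rewrite muleA -!EFinM !mulrA -!natrM.
Qed.

Lemma trunc_nd (t : R) : nondecreasing_seq (fun n => trunc n.+1%:R^-1 t).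
Proof.
move=> n m nm; rewrite !truncE ?invr_gt0//.
have D0 (j : nat) : 0 < 1 + j.+1%:R^-1 * t ^+ 2.
  by rewrite ltr_pwDl// mulr_ge0 ?sqr_ge0 ?invr_ge0.
rewrite ler_wpM2l ?sqr_ge0// lef_pV2 ?posrE//.
by rewrite lerD2l ler_wpM2r ?sqr_ge0// lef_pV2 ?posrE// ler_nat.
Qed.

Lemma trunc_cvg (t : R) : trunc n.+1%:R^-1 t @[n --> \oo] --> t ^+ 2.
Proof.
rewrite (_ : (fun n => trunc n.+1%:R^-1 t) = (fun n => t ^+ 2 / (1 + n.+1%:R^-1 * t ^+ 2))).
  rewrite -[X in _ --> X]divr1; apply: cvgM; first exact: cvg_cst.
  apply: cvgV; first exact: oner_neq0.
  rewrite -[X in _ --> X]addr0; apply: cvgD; first exact: cvg_cst.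
  rewrite -(mul0r (t ^+ 2)); apply: cvgMl.
  exact: cvg_harmonic.
by apply/funext => n; rewrite truncE// invr_gt0.
Qed.

Lemma defective_log tau : 0 < tau -> tau <= 1 -> ineq_I mu tau ->
  exists K : R, 0 <= K /\ forall f, smoothL2 mu f -> \int[mu]_x (f x ^+ 2) = 1 ->
    (I (fun x => f x ^+ 2 * ln (expR 1 + f x ^+ 2)) <= K%:E + K%:E * lenergy mu (2 / tau) f)%E.
Proof.
move=> tau0 tau1 /ineq_I_pos[B [C [B0 C1 hI]]].
set Y := (2 * C) `^ ((1 - tau) / tau); have Y0 : 0 <= Y by exact: powR_ge0.
have CY0 : 0 <= C * Y by rewrite mulr_ge0//; lra.
exists (4 * (2 * B + 6) + 4 * (C * Y)); split; first lra.
move=> f Lf f1; have [Cf _] := Lf.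
have mf := smooth_measurable Cf.
pose q n x := trunc n.+1%:R^-1 (f x).
have mq n : meas (q n).
  apply: measurable_funM; first exact: measurable_funX.
  apply: measurable_powR_comp; apply: measurable_funD => //.
  by apply: measurable_funM => //; exact: measurable_funX.
have q0 n x : 0 <= q n x by exact: trunc_ge0.
apply: (@int_nd_sup _ _ _ mu (fun n x => q n x * ln (expR 1 + q n x))) => [n|n x|x n m nm|x|n].
- apply: measurable_funM => //; apply: measurable_ln_comp; exact: measurable_funD.
- by rewrite mulr_ge0//; have := ln_e_ge1 (q0 n x); lra.
- have qq : q n x <= q m x by exact: trunc_nd.
  apply: ler_pM => //; first by have := ln_e_ge1 (q0 n x); lra.
  by rewrite ler_ln ?posrE ?lerD2l// ltr_wpDr ?expR_gt0.
- have c := trunc_cvg (t := f x); apply: cvgM => //.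
  apply: (@cvg_comp _ _ _ (fun n => expR 1 + q n x) (@ln R) \oo
    (nbhs (expR 1 + f x ^+ 2))); first by apply: cvgD => //; exact: cvg_cst.
  by apply: continuous_ln; rewrite ltr_wpDr ?expR_gt0 ?sqr_ge0.
- have k0 : 0 < n.+1%:R^-1 :> R by rewrite invr_gt0.
  apply: (le_trans (trunc_root_defective tau0 tau1 B0 C1 k0 hI Lf f1)).
  by rewrite -/Y; apply: lee_affine; [exact: lenergy_ge0|lra..].
Qed.

End defective_log.

(** * Lower bounds on the conjugate cost *)

Section conjugate_cost.
Context {R : realType}.
Implicit Types (alpha x y : R).

(** The cost is superlinear: x |y| <= |y|^alpha / alpha as soon as
    |y|^(alpha - 1) >= x alpha, and smaller |y| give a bounded contribution. *)
Lemma cost_conjugate_ubound alpha x : 1 < alpha -> alpha <= 2 -> 0 <= x ->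
  has_ubound [set x * y - cost alpha y | y in [set: R]].
Proof.
move=> a1 a2 x0; have a0 : 0 < alpha by lra.
pose Z := (x * alpha) `^ (alpha - 1)^-1.
have Z0 : 0 <= Z by exact: powR_ge0.
exists (x + 1 + x * Z) => _ [y _ <-]; rewrite /cost.
have xZ : 0 <= x * Z by exact: mulr_ge0.
have xy : x * y <= x * `|y| by rewrite ler_wpM2l// ler_norm.
case: ifPn => [y1|]; first by have := sqr_ge0 y; nra.
rewrite -ltNge => y1; have y0 : 0 < `|y| by lra.
have c1 : - ((alpha - 2) / (2 * alpha)) <= 1.
  by rewrite -mulNr ler_pdivrMr; lra.
have [le|/ltW ge] := leP (x * alpha) (`|y| `^ (alpha - 1)).
  suff : x * `|y| <= `|y| `^ alpha / alpha by lra.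
  rewrite ler_pdivlMr// -(@mulr_powRB1 _ `|y| alpha) ?(ltW y0)//.
  by rewrite mulrAC mulrC ler_pM2l.
have yZ : `|y| <= Z.
  have -> : `|y| = (`|y| `^ (alpha - 1)) `^ (alpha - 1)^-1.
    by rewrite -powRrM mulfV ?powRr1 ?(ltW y0)//; lra.
  apply: ge0_ler_powR; rewrite ?nnegrE ?powR_ge0 ?invr_ge0 ?mulr_ge0//; lra.
have := ler_wpM2l x0 yZ.
have : 0 <= `|y| `^ alpha / alpha by rewrite divr_ge0 ?powR_ge0 ?ltW.
lra.
Qed.

Lemma conjugate_ge alpha x y : 1 < alpha -> alpha <= 2 -> 0 <= x ->
  x * y - cost alpha y <= conjugate (cost alpha) x.
Proof.
move=> a1 a2 x0; apply: ub_le_sup; first exact: cost_conjugate_ubound.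
by exists y.
Qed.

(** The supremum is bounded below by its value at y = x when x <= 1, and at the
    maximizer y = x^(beta - 1) when x > 1.  As beta >= 2, the larger of x^2 and
    x^beta is the first in the former case and the second in the latter. *)
Lemma conjugate_lower alpha x : 1 < alpha -> alpha <= 2 -> 0 <= x ->
  let beta := alpha / (alpha - 1) in
  x `^ beta <= beta * conjugate (cost alpha) x /\
  x ^+ 2 <= beta * conjugate (cost alpha) x.
Proof.
move=> a1 a2 x0 beta.
have b2 : 2 <= beta by rewrite /beta ler_pdivlMr; lra.
have [x1|x1] := leP x 1.
  have h : x ^+ 2 <= beta * conjugate (cost alpha) x.
    have := conjugate_ge x a1 a2 x0.
    by rewrite /cost ger0_norm// x1 => ?; have := sqr_ge0 x; nra.
  split=> //; apply: le_trans h.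
  move: x0; rewrite le_eqVlt => /predU1P[<-|xp].
    by rewrite powR0 ?sqr_ge0//; lra.
  have x01 : 0 < x <= 1 by rewrite xp.
  by have := ger_powR x01 b2; rewrite powR_mulrn// ltW.
have xp : 0 < x by lra.
have h : x `^ beta <= beta * conjugate (cost alpha) x.
  have y1 : 1 < x `^ (beta - 1).
    have b0 : 0 < beta - 1 by lra.
    by have := gt0_ltr_powR b0 _ _ x1; rewrite powR1; apply; rewrite nnegrE// ltW.
  have := conjugate_ge (x `^ (beta - 1)) a1 a2 x0.
  rewrite /cost ger0_norm ?powR_ge0// (lt_geF y1) -powRrM.
  have -> : (beta - 1) * alpha = beta by rewrite /beta; field; lra.
  rewrite mulr_powRB1 ?(ltW xp)//; last by lra.
  have -> : x `^ beta - (x `^ beta / alpha + (alpha - 2) / (2 * alpha)) =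
    x `^ beta / beta + (2 - alpha) / (2 * alpha).
    by rewrite /beta; field; rewrite !gt_eqF; lra.
  have c0 : 0 <= (2 - alpha) / (2 * alpha) by rewrite divr_ge0; lra.
  move=> hh; rewrite mulrC -ler_pdivrMr; lra.
split => //; apply: le_trans h.
by have := ler_powR (ltW x1) b2; rewrite powR_mulrn// ltW.
Qed.

End conjugate_cost.

(** * From the local to the global Poincare inequality *)

Section conditional_measure.
Context {R : realType} (d : nat) (mu : probability 'rV[R]_d R).
Variables (A : set 'rV[R]_d) (mA : measurable A).
Hypothesis A0 : (0 < mu A)%E.
Implicit Types f g : 'rV[R]_d -> R.
Local Notation meas f := (measurable_fun [set: 'rV[R]_d] f).
Local Notation nu := (conditional mu mA).

Lemma conditionalE (U : set 'rV[R]_d) :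
  nu U = (mu (U `&` A) * (fine (mu A))^-1%:E)%E.
Proof.
have Aoo : mu A != +oo%E by rewrite -ltey ltey_eq fin_num_measure.
by rewrite /= /mnormalize /= /mrestr setTI (gt_eqF A0) (negbTE Aoo).
Qed.

Lemma ge0_integral_conditional f : meas f -> (forall x, 0 <= f x) ->
  (\int[nu]_x (f x)%:E = ((fine (mu A))^-1)%:E * \int[mu]_(x in A) (f x)%:E)%E.
Proof.
move=> mf f0.
have p0 : 0 <= (fine (mu A))^-1 by rewrite invr_ge0 fine_ge0.
have mfE : measurable_fun [set: 'rV[R]_d] (EFin \o f) by exact: measurable_EFin.
rewrite -(setUv A) ge0_integral_setU//=; last 4 first.
- exact: measurableC.
- by rewrite setUv.
- by move=> x _; rewrite lee_fin.
- exact/disj_setPCl.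
rewrite [X in (_ + X)%E](eq_measure_integral mzero) => [|U mU UA]; last first.
  apply: etrans (conditionalE U) _.
  by rewrite (_ : U `&` A = set0) ?measure0 ?mul0e//; apply/disjoints_subset.
rewrite integral_measure_zero adde0.
rewrite (eq_measure_integral (mscale (NngNum p0) mu)) => [|U mU UA]; last first.
  by apply: etrans (conditionalE U) _; rewrite (setIidl UA) /= /mscale/= muleC.
rewrite ge0_integral_mscale//; first exact: measurable_funTS.
by move=> x _; rewrite lee_fin.
Qed.

Lemma L1_conditional f : mu.-integrable [set: 'rV[R]_d] (EFin \o f) ->
  nu.-integrable [set: 'rV[R]_d] (EFin \o f).
Proof.
move=> Lf; have mf := L1_measurable Lf; apply/integrableP.
split; first exact: measurable_EFin.
have mnf : meas (fun x => `|f x|) by exact: measurableT_comp.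
rewrite (_ : (\int[nu]_x _)%E = (\int[nu]_x (`|f x|%:E))%E)//.
rewrite ge0_integral_conditional//; apply: lte_mul_pinfty => //.
  by rewrite lee_fin invr_ge0 fine_ge0.
have /integrableP[_] := Lf; apply: le_lt_trans.
apply: ge0_subset_integral => //; exact: measurable_EFin.
Qed.

Lemma Rint_conditional f : mu.-integrable [set: 'rV[R]_d] (EFin \o f) ->
  \int[nu]_x f x = (fine (mu A))^-1 * \int[mu]_(x in A) f x.
Proof.
move=> Lf; have Ln := L1_conditional Lf; have mf := L1_measurable Lf.
have LA : mu.-integrable A (EFin \o f) by apply: integrableS Lf.
have ge0 g : meas g -> (forall x, 0 <= g x) -> mu.-integrable A (EFin \o g) ->
    \int[nu]_x g x = (fine (mu A))^-1 * \int[mu]_(x in A) g x.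
  move=> mg g0 Lg; rewrite /Rintegral ge0_integral_conditional// fineM//.
  exact: integrable_fin_num.
have LN : mu.-integrable [set: 'rV[R]_d] (EFin \o (fun x => `|f x|)).
  exact: integrable_norm.
have LNA : mu.-integrable A (EFin \o (fun x => `|f x|)) by apply: integrableS LN.
have LNn := L1_conditional LN.
have mn := L1_measurable LN.
have fE : f = (fun x => (f x + `|f x|) - `|f x|) by apply/funext => x; rewrite addrK.
have LS : mu.-integrable [set: 'rV[R]_d] (EFin \o (fun x => f x + `|f x|)).
  by have := integrableD measurableT Lf LN; apply: eq_integrable.
have LSA : mu.-integrable A (EFin \o (fun x => f x + `|f x|)) by apply: integrableS LS.
rewrite fE RintegralB//; last exact: L1_conditional.
rewrite [in RHS]RintegralB// mulrBr ge0//; last first.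
- by move=> x; rewrite -lerBlDl sub0r -normrN ler_norm.
- exact: measurable_funD.
by rewrite ge0.
Qed.

End conditional_measure.

Section set_integrals.
Context {R : realType} (d : nat) (mu : probability 'rV[R]_d R).
Implicit Types f g : 'rV[R]_d -> R.
Local Notation meas f := (measurable_fun [set: 'rV[R]_d] f).
Local Notation I f := (\int[mu]_x (f%R x)%:E)%E.

Lemma sum_bound_set (A : set 'rV[R]_d) f (a b : R) : measurable A -> meas f ->
  (forall x, 0 <= f x) -> 0 <= a -> 0 <= b ->
  (\int[mu]_(x in A) (a + b * f x)%:E <= a%:E * mu A + b%:E * I f)%E.
Proof.
move=> mA mf f0 a0 b0.
rewrite (_ : (\int[mu]_(x in A) _)%E =
    (\int[mu]_(x in A) (a%:E + (b * f x)%:E))%E); last by apply: eq_integral.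
rewrite ge0_integralD//; first last.
- by apply: measurable_funTS; apply: measurable_EFin; exact: measurable_funM.
- by move=> x _; rewrite lee_fin mulr_ge0.
rewrite integral_cst//; apply: leeD => //.
rewrite -int_Zl//; apply: ge0_subset_integral => //.
- by apply: measurable_EFin; exact: measurable_funM.
- by move=> x _; rewrite lee_fin mulr_ge0.
Qed.


Lemma le_int_set (A : set 'rV[R]_d) f g : measurable A -> meas f -> meas g ->
  (forall x, 0 <= f x) -> (forall x, f x <= g x) ->
  (\int[mu]_(x in A) (f x)%:E <= \int[mu]_(x in A) (g x)%:E)%E.
Proof.
move=> mA mf mg f0 fg; apply: ge0_le_integral => //.
- by move=> x _; rewrite lee_fin.
- by apply: measurable_funTS; exact: measurable_EFin.
- by apply: measurable_funTS; exact: measurable_EFin.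
- by move=> x _; rewrite lee_fin.
Qed.


End set_integrals.

Section poincare_inequality.
Context {R : realType} (d : nat) (mu : probability 'rV[R]_d R).
Implicit Types f g : 'rV[R]_d -> R.
Local Notation meas f := (measurable_fun [set: 'rV[R]_d] f).
Local Notation I f := (\int[mu]_x (f%R x)%:E)%E.

Lemma logpow_ge0 (tau t : R) : 0 <= logpow tau t.
Proof. exact: powR_ge0. Qed.

Lemma logpow_nd (tau s t : R) : 0 < tau -> 0 <= s -> s <= t -> logpow tau s <= logpow tau t.
Proof.
move=> tau0 s0 st; apply: ge0_ler_powR; rewrite ?nnegrE ?ln_ge0 ?(ltW tau0)//; try lra.
by rewrite ler_ln ?posrE; lra.
Qed.

Lemma logpow_unbounded (tau c : R) : 0 < tau -> 0 <= c ->
  exists M, 0 <= M /\ logpow tau M = c.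
Proof.
move=> tau0 c0; exists (expR (c `^ tau^-1) - 1); split.
  by rewrite subr_ge0 -expR0 ler_expR powR_ge0.
rewrite /logpow (_ : 1 + (expR (c `^ tau^-1) - 1) = expR (c `^ tau^-1)); last by lra.
by rewrite expRK -powRrM mulVf ?powRr1 ?gt_eqF.
Qed.

Lemma absorb_one (b : R) (y : \bar R) : 0 <= b -> (0 <= y)%E ->
  (1%:E <= 2^-1%:E + b%:E * y)%E -> (1%:E <= (2 * b + 1)%:E * y)%E.
Proof.
move=> b0; case: y => [y| |]//; last first.
  by move=> _ _; rewrite gt0_muley ?leey// lte_fin; lra.
by rewrite lee_fin => y0; rewrite -!EFinM -EFinD !lee_fin; nra.
Qed.

(** The mass of u^2 outside A is at most M mu(A^c) plus the part where
    u^2 > M, which the defective inequality bounds by (K + K E(u)) / ln^tau (1 + M).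
    On A the local Poincare inequality leaves the mean of u over A, which is
    small because u has mean 0: it is the opposite of the integral of u over
    A^c, and |u| <= lam u^2 / 2 + 1 / (2 lam).  For M large and then mu(A^c)
    small, all defects sum up to at most 1 / 2. *)
Lemma poincare_normalized tau (K : R) : 0 < tau -> 0 <= K ->
  (forall g, smoothL2 mu g -> \int[mu]_x (g x ^+ 2) = 1 ->
    (I (fun x => g x ^+ 2 * logpow tau (g x ^+ 2)) <= K%:E + K%:E * dirichlet mu g)%E) ->
  local_poincare mu ->
  exists C : R, 0 <= C /\ forall u, smoothL2 mu u -> \int[mu]_x (u x ^+ 2) = 1 ->
    \int[mu]_x u x = 0 -> (1%:E <= C%:E * dirichlet mu u)%E.
Proof.
move=> tau0 K0 hF hloc.
(* M is a level above which ln^tau (1 + u^2) >= 4 K + 1, which reduces the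
   defect K to 1 / 4; lam makes M lam^2 and 8 lam^2 small. *)
have c0 : 0 < 4 * K + 1 by lra.
have [M [M0 PM]] := logpow_unbounded tau0 (ltW c0).
pose lam : R := (8 * (M + 8))^-1.
have lam0 : 0 < lam by rewrite invr_gt0; lra.
have lamM : (M + 8) * lam = 8^-1 by rewrite /lam; field; rewrite gt_eqF//; lra.
have lam1 : lam <= 1 by nra.
have lam2 : lam ^+ 2 <= lam by nra.
have lam4 : lam <= 4^-1 by nra.
have heta : 0 < 1 - lam ^+ 2 < 1.
  apply/andP; split; last by rewrite ltrBlDr ltrDl exprn_gt0.
  by rewrite subr_gt0; nra.
have [A [mA [CA [hA hP]]]] := hloc _ heta.
pose p := fine (mu A).
have pE : mu A = p%:E by rewrite fineK// fin_num_measure.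
have p_ge : 1 - lam ^+ 2 <= p by rewrite -lee_fin -pE.
have p1 : p <= 1 by rewrite -lee_fin -pE probability_le1.
have p0 : 0 < p by nra.
have A0 : (0 < mu A)%E by rewrite pE lte_fin.
have cE : mu (~` A) = (1 - p)%:E by rewrite probability_setC// pE.
have pV1 : 1 <= p^-1 by rewrite invf_ge1.
have pV2 : p^-1 <= 2 by rewrite -[leRHS]invrK lef_pV2 ?posrE//; nra.
pose c := (4 * K + 1)^-1; have cp : 0 < c by rewrite invr_gt0.
have cK : c * K <= 4^-1 by rewrite mulrC ler_pdivrMr//; lra.
(* The local Poincare constant comes without a sign. *)
pose C1 := Order.max CA 0; have C10 : 0 <= C1 by rewrite le_max lexx orbT.
pose b := c * K + 4 * C1.
have b0 : 0 <= b by rewrite addr_ge0// mulr_ge0//; exact: ltW.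
exists (2 * b + 1); split; first lra.
move=> u Lu u1 ubar; have [Cu Iu] := Lu.
apply: absorb_one => //; first exact: dirichlet_ge0.
have mu2 := smoothL2_sqr_measurable Lu.
have mu1 := smooth_measurable Cu.
have u20 x : 0 <= u x ^+ 2 by exact: sqr_ge0.
have LuI := smoothL2_L1 Lu.
pose N x := norm2 (grad u x) ^+ 2.
have mN : meas N by apply: measurable_funX; exact: measurable_norm2_grad.
have N0 x : 0 <= N x by exact: sqr_ge0.
pose G x := u x ^+ 2 * logpow tau (u x ^+ 2).
have mG : meas G.
  by apply: measurable_funM => //; apply: (measurableT_comp (measurable_logpow tau)).
have G0 x : 0 <= G x by rewrite mulr_ge0// logpow_ge0.
have split1 : (1%:E = \int[mu]_(x in A) (u x ^+ 2)%:E + \int[mu]_(x in ~` A) (u x ^+ 2)%:E)%E.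
  rewrite -ge0_integral_setU//=; last 4 first.
  - exact: measurableC.
  - by rewrite setUv; exact: measurable_EFin.
  - by move=> x _; rewrite lee_fin.
  - exact/disj_setPCl.
  by rewrite setUv int_L1// u1.
have tail : (\int[mu]_(x in ~` A) (u x ^+ 2)%:E <=
    (M * (1 - p) + c * K)%:E + (c * K)%:E * dirichlet mu u)%E.
  apply: (@le_trans _ _ (\int[mu]_(x in ~` A) (M + c * G x)%:E)%E).
    apply: le_int_set => //; first exact: measurableC.
    - by apply: measurable_funD => //; exact: measurable_funM.
    - move=> x.
      have [le|/ltW ge] := leP (u x ^+ 2) M.
        by apply: (le_trans le); rewrite lerDl mulr_ge0// ltW.
      apply: (@le_trans _ _ (c * G x)); last by rewrite lerDr.
      rewrite /c ler_pdivlMl// mulrC ler_wpM2l// -PM.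
      exact: logpow_nd.
  apply: le_trans (sum_bound_set _ _ _ _ _ _) _ => //.
  - exact: measurableC.
  - exact: ltW.
  rewrite cE -EFinM EFinD -addeA; apply: leeD => //.
  rewrite !EFinM -!muleA -muleDr//.
  apply: lee_wpmul2l; first by rewrite lee_fin ltW.
  exact: hF.
pose a := \int[conditional mu mA]_x u x.
have aE : a = p^-1 * \int[mu]_(x in A) u x by rewrite /a Rint_conditional.
have LuA : mu.-integrable A (EFin \o u) by exact: integrableS LuI.
have LuC : mu.-integrable (~` A) (EFin \o u).
  by apply: integrableS LuI => //; exact: measurableC.
have split2 : \int[mu]_(x in A) u x = - \int[mu]_(x in ~` A) u x.
  apply/eqP; rewrite -addr_eq0; apply/eqP; rewrite -ubar.
  rewrite -(setUv A) Rintegral_setU//; last 2 first.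
  - by rewrite setUv.
  - exact/disj_setPCl.
  exact: measurableC.
have small : `|\int[mu]_(x in ~` A) u x| <= lam.
  have mC : measurable (~` A) by exact: measurableC.
  rewrite -lee_fin EFin_normr_Rintegral//.
  apply: (le_trans (le_abse_integral _ _ _)) => //.
    by apply: measurable_funTS; exact: measurable_EFin.
  apply: (@le_trans _ _ (\int[mu]_(x in ~` A) ((2 * lam)^-1 + lam / 2 * u x ^+ 2)%:E)%E).
    apply: (@le_int_set _ _ mu (~` A) (fun x => `|u x|)) => //.
    - exact: measurableT_comp.
    - by apply: measurable_funD => //; exact: measurable_funM.
    - move=> x.
      have -> : (2 * lam)^-1 + lam / 2 * u x ^+ 2 =
          `|u x| + (lam / 2) * (`|u x| - lam^-1) ^+ 2.
        have := real_normK (num_real (u x)) => <-; field; rewrite gt_eqF//.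
      by rewrite lerDl mulr_ge0 ?sqr_ge0// divr_ge0// ltW.
  apply: le_trans (sum_bound_set _ _ _ _ _ _) _ => //.
  - by rewrite invr_ge0 mulr_ge0// ltW.
  - by rewrite divr_ge0// ltW.
  rewrite cE (int_L1 Iu) u1 -!EFinM -EFinD lee_fin.
  have : (2 * lam)^-1 * (1 - p) <= lam / 2.
    by rewrite mulrC ler_pdivrMr ?mulr_gt0//; nra.
  lra.
have a2 : a ^+ 2 <= 4 * lam ^+ 2.
  have : `|a| <= 2 * lam.
    rewrite aE split2 normrM normrN ger0_norm ?(le_trans ler01)//.
    by apply: ler_pM => //; exact: le_trans pV1.
  move=> h; rewrite -(real_normK (num_real a)).
  have := normr_ge0 a; nra.
have core : (\int[mu]_(x in A) (u x ^+ 2)%:E <=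
    (8 * lam ^+ 2)%:E + (4 * C1)%:E * dirichlet mu u)%E.
  have nuA g : meas g -> (forall x, 0 <= g x) ->
      (\int[conditional mu mA]_x (g x)%:E = p^-1%:E * \int[mu]_(x in A) (g x)%:E)%E.
    by move=> mg g0; exact: ge0_integral_conditional.
  apply: (@le_trans _ _ (\int[conditional mu mA]_x (u x ^+ 2)%:E)%E).
    rewrite nuA//; rewrite -[leLHS]mul1e; apply: lee_wpmul2r; last by rewrite lee_fin.
    by apply: integral_ge0 => x _; rewrite lee_fin.
  have mua : meas (fun x => `|u x - a| ^+ 2).
    apply: measurable_funX; apply: measurableT_comp => //; exact: measurable_funB.
  apply: (@le_trans _ _ (\int[conditional mu mA]_x (2 * a ^+ 2 + 2 * `|u x - a| ^+ 2)%:E)%E).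
    apply: le_int => //.
      by apply: measurable_funD => //; exact: measurable_funM.
    move=> x; rewrite real_normK ?num_real//; have := sqr_ge0 (u x - 2 * a); nra.
  apply: le_trans (sum_bound_set _ _ _ _ _ _) _ => //.
  - by rewrite mulr_ge0 ?sqr_ge0.
  rewrite probability_setT mule1; apply: leeD; first by rewrite lee_fin; lra.
  have := hP u Cu (L1_conditional mA A0 LuI); rewrite -/a => hPu.
  apply: (@le_trans _ _ (2%:E * (C1%:E * \int[conditional mu mA]_x (N x)%:E))%E).
    apply: lee_wpmul2l; first by rewrite lee_fin.
    apply: (le_trans hPu); apply: lee_wpmul2r; first by apply: integral_ge0 => x _; rewrite lee_fin sqr_ge0.
    by rewrite lee_fin le_max lexx.
  rewrite muleA -EFinM nuA// muleA -EFinM.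
  apply: lee_pmul.
  - by rewrite lee_fin !mulr_ge0// (le_trans ler01).
  - by apply: integral_ge0 => x _; rewrite lee_fin.
  - by rewrite lee_fin; nra.
  - apply: ge0_subset_integral => //; first exact: measurable_EFin.
    by move=> x _; rewrite lee_fin.
rewrite split1; apply: (le_trans (leeD core tail)).
rewrite addeACA -EFinD -ge0_muleDl ?lee_fin ?mulr_ge0 ?(ltW cp)//.
rewrite -EFinD; apply: lee_affine; first exact: dirichlet_ge0.
- by nra.
- by rewrite /b; lra.
Qed.

End poincare_inequality.

(** * Pointwise inequalities for the tightening *)

Section tight_real.
Context {R : realType}.
Implicit Types (t x y L tau s k : R).

(** A concave function lies below its tangents.  For the power this is Bernoulli's
    inequality for x / y, which is Young's inequality with exponents 1 / tau and
    1 / (1 - tau) applied to (x / y)^tau and 1. *)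
Lemma powR_tangent tau x y : 0 < tau -> tau <= 1 -> 0 <= x -> 0 < y ->
  x `^ tau <= y `^ tau + tau * y `^ (tau - 1) * (x - y).
Proof.
move=> tau0 tau1 x0 y0.
have r0 : 0 <= x / y by rewrite divr_ge0// ltW.
have bern : (x / y) `^ tau <= 1 + tau * (x / y - 1).
  move: tau1; rewrite le_eqVlt => /predU1P[->|tau1].
    by rewrite powRr1// mul1r addrC subrK.
  have p0 : 0 < tau^-1 by rewrite invr_gt0.
  have q0 : 0 < (1 - tau)^-1 by rewrite invr_gt0; lra.
  have pq : tau^-1^-1 + (1 - tau)^-1^-1 = 1 by rewrite !invrK; lra.
  have := conjugate_powR (powR_ge0 (x / y) tau) ler01 p0 q0 pq.
  by rewrite mulr1 -powRrM mulfV ?gt_eqF// powRr1// powR1 !invrK; lra.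
have y1 : y `^ tau = y * y `^ (tau - 1) by rewrite mulr_powRB1// ltW.
have yt : 0 <= y `^ tau by exact: powR_ge0.
have -> : x = (x / y) * y by rewrite divfK ?gt_eqF.
rewrite powRM ?(ltW y0)//.
apply: (@le_trans _ _ ((1 + tau * (x / y - 1)) * y `^ tau)).
  by rewrite ler_wpM2r.
rewrite y1 le_eqVlt; apply/orP; left; apply/eqP.
by ring.
Qed.

(** The derivative of [F_ tau] at 1. *)
Definition slope tau : R := tau * ln 2 `^ (tau - 1) / 2.

Lemma slope_ge0 tau : 0 < tau -> 0 <= slope tau.
Proof. by move=> tau0; rewrite divr_ge0// mulr_ge0 ?powR_ge0 ?ltW. Qed.

Lemma F_tangent tau t : 0 < tau -> tau <= 1 -> 0 <= t -> F_ tau t <= slope tau * (t - 1).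
Proof.
move=> tau0 tau1 t0; have l2 : 0 < ln 2 :> R by apply: ln_gt0; lra.
have lt0 : 0 <= ln (1 + t) by apply: ln_ge0; lra.
have := powR_tangent tau0 tau1 lt0 l2; rewrite /F_.
have : ln (1 + t) - ln 2 <= (t - 1) / 2.
  rewrite -ln_div ?posrE//; last by lra.
  by have := @ln_le_sub1 R ((1 + t) / 2); lra.
have : 0 <= tau * ln 2 `^ (tau - 1) by rewrite mulr_ge0 ?powR_ge0 ?ltW.
rewrite /slope; set A := tau * _; nra.
Qed.

Lemma logpow_4 tau t : 0 < tau -> tau <= 1 -> 0 <= t ->
  logpow tau (4 * t) <= 4 * logpow tau t.
Proof.
move=> tau0 tau1 t0; rewrite /logpow.
have l0 : 0 <= ln (1 + t) by apply: ln_ge0; lra.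
apply: (@le_trans _ _ ((4 * ln (1 + t)) `^ tau)).
  apply: ge0_ler_powR; rewrite ?nnegrE ?(ltW tau0)//.
  - by apply: ln_ge0; lra.
  - by rewrite mulr_ge0.
  have -> : 4 * ln (1 + t) = ln ((1 + t) ^+ 4) by rewrite lnXn ?mulr_natl//; lra.
  rewrite ler_ln ?posrE ?exprn_gt0//; [|lra|lra].
  have -> : (1 + t) ^+ 4 = 1 + 4 * t + t ^+ 2 * (6 + 4 * t + t ^+ 2) by ring.
  by rewrite lerDl mulr_ge0 ?sqr_ge0//; nra.
by rewrite powRM// ler_wpM2r ?powR_ge0// ler1_powR//; lra.
Qed.

Lemma sqr_sub1_le (g : R) : `|g| <= 2 -> (g ^+ 2 - 1) ^+ 2 <= 9 * (`|g| - 1) ^+ 2.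
Proof.
move=> g2; rewrite -(real_normK (num_real g)); set z := `|g| in g2 *.
have z0 : 0 <= z by exact: normr_ge0.
have -> : (z ^+ 2 - 1) ^+ 2 = (z - 1) ^+ 2 * (z + 1) ^+ 2 by ring.
rewrite mulrC ler_wpM2r ?sqr_ge0//; nra.
Qed.

(** For |g| <= 2 the tangent at 1 gives
    t F(t) <= slope t (t - 1) = slope (t - 1) + slope (t - 1)^2.  For |g| > 2 the
    hypothesis gives |g| <= 2 |w|, and then t F(t) <= 4 w^2 ln^tau (1 + 4 w^2).  In
    the application w is g - int g. *)
Lemma F_pointwise tau (g w : R) : 0 < tau -> tau <= 1 -> `|g| - 1 <= `|w| ->
  g ^+ 2 * F_ tau (g ^+ 2) <= (- slope tau + slope tau * g ^+ 2) +
    (9 * slope tau * (`|g| - 1) ^+ 2 + 16 * (w ^+ 2 * logpow tau (w ^+ 2))).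
Proof.
move=> tau0 tau1 gw; have a0 := slope_ge0 tau0.
have t0 : 0 <= g ^+ 2 by exact: sqr_ge0.
have w0 : 0 <= w ^+ 2 by exact: sqr_ge0.
have P0 : 0 <= w ^+ 2 * logpow tau (w ^+ 2) by rewrite mulr_ge0 ?logpow_ge0.
have [g2|/ltW g2] := leP `|g| 2.
  have h1 := ler_wpM2l t0 (F_tangent tau0 tau1 t0).
  have h2 := ler_wpM2l a0 (sqr_sub1_le g2).
  apply: (le_trans h1).
  have -> : g ^+ 2 * (slope tau * (g ^+ 2 - 1)) =
    (- slope tau + slope tau * g ^+ 2) + slope tau * (g ^+ 2 - 1) ^+ 2 by ring.
  by rewrite lerD2l; move: h2; rewrite mulrCA mulrA => h2; lra.
have g4 : 4 <= g ^+ 2 by rewrite -(real_normK (num_real g)); nra.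
have gw4 : g ^+ 2 <= 4 * w ^+ 2.
  by rewrite -(real_normK (num_real g)) -(real_normK (num_real w)); nra.
have h : g ^+ 2 * F_ tau (g ^+ 2) <= 16 * (w ^+ 2 * logpow tau (w ^+ 2)).
  apply: (@le_trans _ _ (g ^+ 2 * logpow tau (g ^+ 2))).
    by rewrite ler_wpM2l// /F_ gerBl powR_ge0.
  apply: (@le_trans _ _ (4 * w ^+ 2 * (4 * logpow tau (w ^+ 2)))); last by lra.
  apply: ler_pM => //; first exact: logpow_ge0.
  by apply: le_trans (logpow_4 tau0 tau1 w0); exact: logpow_nd.
have h2 : 0 <= 9 * slope tau * (`|g| - 1) ^+ 2.
  by rewrite mulr_ge0 ?sqr_ge0// mulr_ge0.
nra.
Qed.

(** (t^2 - 1) / (t^2 + 1): it vanishes exactly where |t| = 1, and its modulus is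
    at most 1. *)
Definition ratio t := (t ^+ 2 - 1) * (1 + t ^+ 2) `^ (-1).
(** A smooth even function that grows like |t| and vanishes to the order n + 1
    where |t| = 1. *)
Definition excess n t := (1 + t ^+ 2) `^ 2^-1 * ratio t ^+ n.+1.

Lemma sqr1_gt0 t : 0 < 1 + t ^+ 2.
Proof. by rewrite ltr_pwDl// sqr_ge0. Qed.

Lemma ratioE t : ratio t = (t ^+ 2 - 1) / (1 + t ^+ 2).
Proof. by rewrite /ratio powR_inv1// ltW// sqr1_gt0. Qed.

Lemma ratio_le1 t : `|ratio t| <= 1.
Proof.
have D0 := sqr1_gt0 t; have t2 := sqr_ge0 t.
rewrite ratioE ler_norml ler_pdivlMr// ler_pdivrMr//; apply/andP; split; lra.
Qed.

Lemma excess_sqr n t : excess n t ^+ 2 = (1 + t ^+ 2) * `|ratio t| ^+ (2 * n.+1).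
Proof.
rewrite /excess exprMn powR_half_sqr ?ltW ?sqr1_gt0//; congr (_ * _).
by rewrite exprM real_normK ?num_real// -!exprM mulnC.
Qed.

Lemma excess_sqr_le n t : excess n t ^+ 2 <= 2 * (`|t| - 1) ^+ 2.
Proof.
have D0 := sqr1_gt0 t.
apply: (@le_trans _ _ ((1 + t ^+ 2) * `|ratio t| ^+ 2)).
  rewrite excess_sqr ler_wpM2l ?(ltW D0)//.
  by apply: ler_wiXn2l; rewrite ?ratio_le1 ?normr_ge0// mulnS.
rewrite real_normK ?num_real// ratioE.
have -> : (1 + t ^+ 2) * ((t ^+ 2 - 1) / (1 + t ^+ 2)) ^+ 2 = (t ^+ 2 - 1) ^+ 2 / (1 + t ^+ 2).
  by field; rewrite gt_eqF.
rewrite ler_pdivrMr//; move: D0; rewrite -(real_normK (num_real t)).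
set z := `|t| => D0; have z0 : 0 <= z by exact: normr_ge0.
have -> : (z ^+ 2 - 1) ^+ 2 = (z - 1) ^+ 2 * (z + 1) ^+ 2 by ring.
have -> : 2 * (z - 1) ^+ 2 * (1 + z ^+ 2) = (z - 1) ^+ 2 * (2 * (1 + z ^+ 2)) by ring.
by rewrite ler_wpM2l ?sqr_ge0//; have := sqr_ge0 (z - 1); nra.
Qed.

Lemma excess_derive n t : is_derive t 1 (excess n)
  (ratio t ^+ n * (t / (1 + t ^+ 2) `^ 2^-1) * (ratio t + 4 * n.+1%:R / (1 + t ^+ 2))).
Proof.
have D0 := sqr1_gt0 t.
have dD := is_derive_sqrD 1 t.
have dA := is_derive1_comp (g := fun y => 1 + y ^+ 2) (is_derive1_powR 2^-1 D0) dD.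
have dV := is_derive1_comp (g := fun y => 1 + y ^+ 2) (is_derive1_powR (-1) D0) dD.
have dN : is_derive t 1 (fun y : R => y ^+ 2 - 1) (2 * t).
  have := is_derive_sqrD (-1) t; congr (is_derive _ _ _ _).
  by apply/funext => y; rewrite addrC.
have dr : is_derive t 1 ratio ((t ^+ 2 - 1) * (-1 * (1 + t ^+ 2) `^ (-1 - 1) * (2 * t)) +
    (1 + t ^+ 2) `^ (-1) * (2 * t)).
  exact: (is_deriveM dN dV).
have dE : is_derive (ratio t) 1 (fun y : R => y ^+ n.+1) (n.+1%:R * ratio t ^+ n).
  apply: DeriveDef; first exact: exprn_derivable.
  by rewrite exp_derive /GRing.scale/= mulr1.
have dX := is_derive1_comp (g := ratio) dE dr.
have dH := is_deriveM dA dX.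
apply: (is_derive_eq dH); rewrite /GRing.scale/=.
set r := (1 + t ^+ 2) `^ 2^-1; have r2 : r ^+ 2 = 1 + t ^+ 2 by exact: powR_half_sqr (ltW D0).
have r0 : 0 < r by exact: powR_gt0.
have -> : (1 + t ^+ 2) `^ (2^-1 - 1) = r^-1.
  by rewrite -powRN; congr (_ `^ _); lra.
have -> : (1 + t ^+ 2) `^ (-1 - 1) = ((1 + t ^+ 2) ^+ 2)^-1.
  rewrite powRD; last by rewrite (gt_eqF D0) implybT.
  by rewrite powR_inv1 ?ltW// expr2 invfM.
rewrite powR_inv1 ?(ltW D0)//.
have -> : ratio t ^+ n.+1 = ratio t * ratio t ^+ n by rewrite exprS.
set q := ratio t ^+ n; rewrite ratioE -r2.
have tE : t ^+ 2 = r ^+ 2 - 1 by rewrite r2; lra.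
rewrite tE; field.
by rewrite gt_eqF.
Qed.

(** The factor by which [excess] multiplies the logarithmic gradient is at most
    4 (n + 1) t^2 / (1 + t^2) / |ratio|, so it is singular where |t| = 1; the factor
    |ratio|^(2 (n + 1)) in the square of [excess] compensates this, as
    2 (n + 1) >= beta. *)
Lemma excess_energy n (beta t : R) : 1 <= beta -> beta <= (2 * n.+1)%:R ->
  excess n t ^+ 2 *
  `|ratio t ^+ n * (t / (1 + t ^+ 2) `^ 2^-1) * (ratio t + 4 * n.+1%:R / (1 + t ^+ 2))
     * t / excess n t| `^ beta <=
  (4 * n.+1%:R) `^ beta * t ^+ 2.
Proof.
move=> b1 bn; have D0 := sqr1_gt0 t; have t20 := sqr_ge0 t.
set r := (1 + t ^+ 2) `^ 2^-1; have r2 : r ^+ 2 = 1 + t ^+ 2 by exact: powR_half_sqr (ltW D0).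
have r0 : 0 < r by exact: powR_gt0.
pose p : R := n.+1%:R; have p1 : 1 <= p by rewrite ler1n.
rewrite -/p; set z := `|_|.
have [rho0|rhoN] := eqVneq (ratio t) 0.
  rewrite excess_sqr rho0 normr0 expr0n/= mulr0 mul0r.
  by rewrite mulr_ge0 ?powR_ge0.
have rz : `|ratio t| * z <= 4 * p * (t ^+ 2 / (1 + t ^+ 2)).
  have -> : `|ratio t| * z = t ^+ 2 / (1 + t ^+ 2) * ((t ^+ 2 - 1 + 4 * p) / (1 + t ^+ 2)).
    rewrite -normrM -[RHS]ger0_norm; last first.
      by rewrite mulr_ge0// divr_ge0 ?(ltW D0)//; lra.
    congr (`| _ |).
    rewrite /excess -/r [ratio t ^+ n.+1]exprS.
    have qN : ratio t ^+ n != 0 by rewrite expf_neq0.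
    have -> : ratio t * (ratio t ^+ n * (t / r) * (ratio t + 4 * p / (1 + t ^+ 2)) * t /
       (r * (ratio t * ratio t ^+ n))) = t ^+ 2 / r ^+ 2 * (ratio t + 4 * p / (1 + t ^+ 2)).
      by field; rewrite rhoN qN gt_eqF// gt_eqF.
    by rewrite r2 ratioE; congr (_ * _); field; rewrite gt_eqF.
  rewrite mulrC ler_wpM2r ?divr_ge0 ?(ltW D0)// ler_pdivrMr//; nra.
have s1 : t ^+ 2 / (1 + t ^+ 2) <= 1 by rewrite ler_pdivrMr// mul1r lerDr.
have s0 : 0 <= t ^+ 2 / (1 + t ^+ 2) by rewrite divr_ge0// ltW.
rewrite excess_sqr -mulrA.
apply: (@le_trans _ _ ((1 + t ^+ 2) * ((4 * p) `^ beta * (t ^+ 2 / (1 + t ^+ 2))))); last first.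
  by rewrite le_eqVlt; apply/orP; left; apply/eqP; field; rewrite gt_eqF.
rewrite ler_wpM2l ?(ltW D0)//.
have n0 : 0 < `|ratio t| <= 1 by rewrite normr_gt0 rhoN ratio_le1.
apply: (@le_trans _ _ (`|ratio t| `^ beta * z `^ beta)).
  rewrite ler_wpM2r ?powR_ge0//.
  by have := ger_powR n0 bn; rewrite powR_mulrn ?normr_ge0.
rewrite -powRM ?normr_ge0//.
apply: (@le_trans _ _ ((4 * p * (t ^+ 2 / (1 + t ^+ 2))) `^ beta)).
  have h1 : 0 <= `|ratio t| * z by rewrite mulr_ge0 ?normr_ge0.
  by apply: ge0_ler_powR; rewrite ?nnegrE//; [lra|exact: le_trans rz].
rewrite powRM//; last by lra.
rewrite ler_wpM2l ?powR_ge0//.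
move: s0; rewrite le_eqVlt => /predU1P[<-|s0]; first by rewrite powR0// gt_eqF//; lra.
by apply: ge1r_powR => //; rewrite s0.
Qed.

(** Iteration of [ln_e_half]. *)
Lemma ln_e_pow2 m (y : R) : 0 <= y ->
  2^-1 ^+ m * ln (expR 1 + y) <= ln (expR 1 + 2^-1 ^+ m * y).
Proof.
move=> y0; elim: m => [|m IH]; first by rewrite expr0 !mul1r.
have ym : 0 <= 2^-1 ^+ m * y by rewrite mulr_ge0// exprn_ge0.
have := ln_e_half ym; rewrite (_ : 2^-1 ^+ m * y / 2 = 2^-1 ^+ m.+1 * y).
  by rewrite exprS; lra.
by rewrite exprS; ring.
Qed.

(** For |g| <= 2 this is ln t <= t - 1 with t = g^2.  For |g| > 2 the ratio is at
    least 3 / 5 > 1 / 2, so the square of [excess] is at least a constant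
    multiple of g^2, and the same holds for the logarithms by [ln_e_pow2]. *)
Lemma entropy_pointwise n (g : R) :
  g ^+ 2 * ln (g ^+ 2) <= (- 1 + 1 * g ^+ 2) +
   (9 * (`|g| - 1) ^+ 2 +
    (4 ^+ (2 * n.+2)) * (excess n g ^+ 2 * ln (expR 1 + excess n g ^+ 2 / 4))).
Proof.
have t0 : 0 <= g ^+ 2 by exact: sqr_ge0.
have u0 : 0 <= excess n g ^+ 2 by exact: sqr_ge0.
have u4 : 0 <= excess n g ^+ 2 / 4 by rewrite divr_ge0.
have L1 := ln_e_ge1 u4.
have P0 : 0 <= (4 ^+ (2 * n.+2)) * (excess n g ^+ 2 * ln (expR 1 + excess n g ^+ 2 / 4)).
  by apply: mulr_ge0; [exact: exprn_ge0|apply: mulr_ge0 => //; lra].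
have [g2|/ltW g2] := leP `|g| 2.
  move: P0; set X := 4 ^+ _ * _ => P0.
  have h : g ^+ 2 * ln (g ^+ 2) <= g ^+ 2 * (g ^+ 2 - 1).
    move: t0; rewrite le_eqVlt => /predU1P[<-|t0]; first by rewrite !mul0r.
    by rewrite ler_pM2l//; exact: ln_le_sub1.
  have h9 := sqr_sub1_le g2; set Y := 9 * _ in h9 *.
  rewrite mul1r; set t := g ^+ 2 in h h9 *; lra.
have g4 : 4 <= g ^+ 2 by rewrite -(real_normK (num_real g)); nra.
suff h : g ^+ 2 * ln (g ^+ 2) <=
    (4 ^+ (2 * n.+2)) * (excess n g ^+ 2 * ln (expR 1 + excess n g ^+ 2 / 4)).
  move: h; set X := 4 ^+ _ * _ => h.
  have := sqr_ge0 (`|g| - 1); lra.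
(* Two factors 1 / 2 more than in the lower bound 2^-(2 (n + 1)) for the
   power of the ratio: they make up for the division by 4. *)
pose c : R := 2^-1 ^+ (2 * n.+2).
have c0 : 0 < c by rewrite exprn_gt0// invr_gt0.
have D0 := sqr1_gt0 g.
have u_lower : 4 * c * g ^+ 2 <= excess n g ^+ 2.
  rewrite excess_sqr.
  have -> : 4 * c = (2^-1) ^+ (2 * n.+1).
    by rewrite /c mulnS exprD; field.
  rewrite mulrC; apply: ler_pM => //; rewrite ?exprn_ge0//; first by lra.
  apply: lerXn2r; rewrite ?nnegrE ?invr_ge0//.
  rewrite ratioE ger0_norm; last by rewrite divr_ge0; lra.
  by rewrite ler_pdivlMr//; lra.
have t1 : 0 < g ^+ 2 by lra.
have lnt : 0 <= ln (g ^+ 2) by apply: ln_ge0; lra.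
have l1 : c * ln (g ^+ 2) <= ln (expR 1 + excess n g ^+ 2 / 4).
  apply: (@le_trans _ _ (c * ln (expR 1 + g ^+ 2))).
    rewrite ler_pM2l// ler_ln ?posrE//; last by rewrite addr_gt0// expR_gt0.
    by rewrite lerDr expR_ge0.
  apply: (le_trans (ln_e_pow2 _ t0)).
  have cg : 0 <= c * g ^+ 2 by rewrite mulr_ge0// ltW.
  rewrite ler_ln ?posrE ?lerD2l ?ltr_wpDr ?expR_gt0//.
  by rewrite -/c ler_pdivlMr//; lra.
have l2 : c * g ^+ 2 <= excess n g ^+ 2 by apply: le_trans u_lower; nra.
have := ler_pM (mulr_ge0 (ltW c0) t0) (mulr_ge0 (ltW c0) lnt) l2 l1 => h.
have -> : 4 ^+ (2 * n.+2) = c^-1 * c^-1 :> R.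
  by rewrite -invfM /c -exprMn -exprVn; congr (_ ^+ _); lra.
have cV0 : 0 <= c^-1 by rewrite invr_ge0 ltW.
have := ler_wpM2l (mulr_ge0 cV0 cV0) h; apply: le_trans.
by rewrite le_eqVlt; apply/orP; left; apply/eqP; field; rewrite gt_eqF.
Qed.

End tight_real.

(** * Tightening *)

Section ereal_combinations.
Context {R : realType}.
Local Open Scope ereal_scope.
Implicit Types (x y z : \bar R) (a b p q : R).

Lemma lee_combine a b p q x y z : (0 <= a)%R -> (0 <= b)%R -> (0 <= p)%R ->
  (0 <= q)%R -> 0 <= y -> x <= p%:E * y -> z <= q%:E * y ->
  a%:E * x + b%:E * z <= (a * p + b * q)%:E * y.
Proof.
move=> a0 b0 p0 q0 y0 xy zy.
rewrite EFinD ge0_muleDl ?lee_fin ?mulr_ge0// !EFinM -!muleA.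
by apply: leeD; apply: lee_wpmul2l; rewrite ?lee_fin.
Qed.

Lemma lee_combine_sum a p q q' x y y' z : (0 <= a)%R -> (0 <= p)%R ->
  (0 <= q)%R -> (0 <= q')%R -> 0 <= y -> 0 <= y' ->
  x <= p%:E * y -> z <= q%:E * y + q'%:E * y' ->
  x + a%:E * z <= (p + a * q + a * q')%:E * (y + y').
Proof.
move=> a0 p0 q0 q'0 y0 y'0 xy zy.
apply: (@le_trans _ _ (p%:E * y + a%:E * (q%:E * y + q'%:E * y'))).
  by apply: leeD => //; apply: lee_wpmul2l; rewrite ?lee_fin.
rewrite ge0_muleDr ?mule_ge0 ?lee_fin// !muleA -!EFinM addeA.
rewrite -ge0_muleDl ?lee_fin ?mulr_ge0// -EFinD ge0_muleDr//.
have h1 := mulr_ge0 a0 q0; have h2 := mulr_ge0 a0 q'0.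
by apply: leeD; apply: lee_wpmul2r; rewrite ?lee_fin//; lra.
Qed.

End ereal_combinations.

Section tightening.
Context {R : realType} (d : nat) (mu : probability 'rV[R]_d R).
Implicit Types f g : 'rV[R]_d -> R.
Local Notation meas f := (measurable_fun [set: 'rV[R]_d] f).
Local Notation I f := (\int[mu]_x (f%R x)%:E)%E.
Local Notation L1 f := (mu.-integrable [set: 'rV[R]_d] (EFin \o f)).

Lemma Rint_sqr_sub (c : R) f : smoothL2 mu f ->
  \int[mu]_x ((f x - c) ^+ 2) = \int[mu]_x (f x ^+ 2) - 2 * c * \int[mu]_x f x + c ^+ 2.
Proof.
move=> Lf; have [Cf If] := Lf; have L1f := smoothL2_L1 Lf.
have La := L1_affine (c ^+ 2) (- (2 * c)) L1f.
rewrite (_ : (fun x => (f x - c) ^+ 2) =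
  (fun x => f x ^+ 2 + (c ^+ 2 + (- (2 * c)) * f x))); last by apply/funext => x; ring.
by rewrite RintegralD// Rint_affine//; ring.
Qed.

Definition variance_poincare (C : R) := forall f, smoothL2 mu f ->
  ((\int[mu]_x (f x ^+ 2) - (\int[mu]_x f x) ^+ 2)%:E <= C%:E * dirichlet mu f)%E.

(** The normalized inequality is applied to (f - int f) divided by its L2
    norm. *)
Lemma poincare_variance (C : R) : 0 <= C ->
  (forall u, smoothL2 mu u -> \int[mu]_x (u x ^+ 2) = 1 ->
    \int[mu]_x u x = 0 -> (1%:E <= C%:E * dirichlet mu u)%E) ->
  variance_poincare C.
Proof.
move=> C0 H f Lf; have [Cf If] := Lf; have L1f := smoothL2_L1 Lf.
set m := \int[mu]_x f x.
pose w x := f x - m; have Lw : smoothL2 mu w by exact: smoothL2_B.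
have [Cw Iw] := Lw.
set v := \int[mu]_x (f x ^+ 2) - m ^+ 2.
have vE : \int[mu]_x (w x ^+ 2) = v by rewrite Rint_sqr_sub// -/m /v; ring.
have w0 : \int[mu]_x w x = 0.
  rewrite (_ : w = (fun x => - m + 1 * f x)); last by apply/funext => x; rewrite /w; ring.
  by rewrite Rint_affine// -/m mul1r addNr.
have v0 : 0 <= v by rewrite -vE; apply: Rintegral_ge0 => x _; exact: sqr_ge0.
move: (v0); rewrite le_eqVlt => /predU1P[<-|vp].
  by rewrite mule_ge0 ?dirichlet_ge0.
pose c := (Num.sqrt v)^-1.
have c2 : c ^+ 2 = v^-1 by rewrite /c exprVn sqr_sqrtr.
have c0 : c != 0 by rewrite invr_eq0 sqrtr_eq0 -ltNge.
have Lu := smoothL2_Z c Lw.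
have u1 : \int[mu]_x ((c * w x) ^+ 2) = 1.
  rewrite (_ : (fun x => (c * w x) ^+ 2) = (fun x => 0 + v^-1 * w x ^+ 2)).
    by rewrite Rint_affine// vE add0r mulVf// gt_eqF.
  by apply/funext => x; rewrite exprMn c2 add0r.
have u0 : \int[mu]_x (c * w x) = 0.
  by rewrite RintegralZl ?w0 ?mulr0//; exact: smoothL2_L1.
have := H _ Lu u1 u0; rewrite dirichlet_Z// c2 dirichlet_B// => h.
have v0' : (0 <= v%:E)%E by rewrite lee_fin.
have := lee_wpmul2l v0' h; rewrite mule1 muleCA [X in (_ * X)%E]muleA -EFinM.
by rewrite mulfV ?gt_eqF// mul1e.
Qed.

(** As |f| <= (1 + f^2) / 2, the integral N of |f| is at most 1, and the squared
    distance of |f| to 1 is 2 - 2 N <= 2 (1 - N^2): it is controlled by the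
    variance of |f|. *)
Lemma abs_dev_le f : smoothL2 mu f -> \int[mu]_x (f x ^+ 2) = 1 ->
  [/\ L1 (fun x => `|f x|), L1 (fun x => (`|f x| - 1) ^+ 2),
    0 <= \int[mu]_x `|f x|, \int[mu]_x `|f x| <= 1 &
    \int[mu]_x ((`|f x| - 1) ^+ 2) = 2 - 2 * \int[mu]_x `|f x| ].
Proof.
move=> Lf f1; have [Cf If] := Lf.
have La : L1 (fun x => `|f x|) by exact/integrable_norm/smoothL2_L1.
have E x : (`|f x| - 1) ^+ 2 = f x ^+ 2 + (1 + (- 2) * `|f x|).
  by rewrite -(real_normK (num_real (f x))); ring.
have Ls : L1 (fun x => (`|f x| - 1) ^+ 2).
  have := integrableD measurableT If (L1_affine 1 (-2) La).
  by apply: eq_integrable => // x _; rewrite /= E.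
have IE : \int[mu]_x ((`|f x| - 1) ^+ 2) = 2 - 2 * \int[mu]_x `|f x|.
  under eq_Rintegral do rewrite E.
  rewrite RintegralD//; last exact: L1_affine.
  by rewrite Rint_affine// f1; ring.
split => //; first by apply: Rintegral_ge0.
have : 0 <= \int[mu]_x ((`|f x| - 1) ^+ 2) by apply: Rintegral_ge0 => x _; exact: sqr_ge0.
by rewrite IE; lra.
Qed.

(** With m = int g, the integral of (|g| - 1)^2 is at most 2 (1 - |m|) <=
    2 (1 - m^2), twice the variance, and the defective inequality for g - m has
    a defect proportional to the variance. *)
Lemma tight_F tau (K C : R) : 0 < tau -> tau <= 1 -> 0 <= K -> 0 <= C ->
  (forall g, smoothL2 mu g -> \int[mu]_x (g x ^+ 2) = 1 ->
    (I (fun x => g x ^+ 2 * logpow tau (g x ^+ 2)) <= K%:E + K%:E * dirichlet mu g)%E) ->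
  variance_poincare C ->
  forall g, smoothL2 mu g -> \int[mu]_x (g x ^+ 2) = 1 ->
    (I (fun x => g x ^+ 2 * F_ tau (g x ^+ 2)) <=
      (18 * slope tau * C + 16 * (K * C + K))%:E * dirichlet mu g)%E.
Proof.
move=> tau0 tau1 K0 C0 HF HP g Lg g1.
have [Cg Ig] := Lg; have L1g := smoothL2_L1 Lg.
have [La Ls n0 n1 sE] := abs_dev_le Lg g1.
set m := \int[mu]_x g x; set n := \int[mu]_x `|g x| in n0 n1 sE.
have mn : `|m| <= n by exact: le_normr_Rintegral.
have a0 := slope_ge0 tau0.
pose w x := g x - m; have Lw : smoothL2 mu w by exact: smoothL2_B.
have vE : \int[mu]_x (w x ^+ 2) = 1 - m ^+ 2 by rewrite Rint_sqr_sub// -/m g1; ring.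
have vle : ((1 - m ^+ 2)%:E <= C%:E * dirichlet mu g)%E by rewrite -g1; exact: HP.
have E0 := dirichlet_ge0 mu g.
have mg2 := smoothL2_sqr_measurable Lg; have mw2 := smoothL2_sqr_measurable Lw.
have mlw : meas (fun x => w x ^+ 2 * logpow tau (w x ^+ 2)).
  by apply: measurable_funM => //; apply: (measurableT_comp (measurable_logpow tau)).
have w0 x : 0 <= w x ^+ 2 * logpow tau (w x ^+ 2).
  by rewrite mulr_ge0 ?sqr_ge0 ?logpow_ge0.
have ms := L1_measurable Ls.
have m2 : m ^+ 2 <= 1.
  by rewrite -(real_normK (num_real m)) expr_le1// (le_trans mn).
have Iw : (I (fun x => w x ^+ 2 * logpow tau (w x ^+ 2)) <=
    (K * C + K)%:E * dirichlet mu g)%E.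
  have hK : forall u, smoothL2 mu u -> \int[mu]_x (u x ^+ 2) = 1 ->
    (I (fun x => u x ^+ 2 * logpow tau (u x ^+ 2)) <= K%:E + K%:E * dirichlet mu u)%E.
    exact: HF.
  have := @homogenize_le _ _ mu _ (measurable_logpow tau) (dirichlet mu)
    (dirichlet_ge0 mu) (dirichlet_Z mu) K K K0 K0 hK
    (fun s t => @logpow_nd _ tau s t tau0) w 1 Lw ltr01.
  rewrite vE gerBl sqr_ge0 => /(_ isT).
  under eq_integral do rewrite divr1.
  move=> h; apply: (le_trans h).
  rewrite (dirichlet_B mu m Cg : dirichlet mu w = _) EFinM.
  have := lee_combine K0 K0 C0 ler01 E0 vle (_ : dirichlet mu g <= 1%:E * dirichlet mu g)%E.
  by rewrite mul1e mulr1; exact.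
have Is : ((\int[mu]_x ((`|g x| - 1) ^+ 2))%:E <= (2 * C)%:E * dirichlet mu g)%E.
  rewrite EFinM -muleA; apply: (@le_trans _ _ (2%:E * (1 - m ^+ 2)%:E)%E).
    rewrite -EFinM lee_fin sE -(real_normK (num_real m)).
    have := normr_ge0 m; nra.
  by apply: lee_wpmul2l.
have Lj : L1 (fun x => - slope tau + slope tau * g x ^+ 2) by exact: L1_affine.
pose r x := 9 * slope tau * (`|g x| - 1) ^+ 2 + 16 * (w x ^+ 2 * logpow tau (w x ^+ 2)).
have s9 : 0 <= 9 * slope tau by rewrite mulr_ge0.
have mr1 : meas (fun x => 9 * slope tau * (`|g x| - 1) ^+ 2) by exact: measurable_funM.
have mr2 : meas (fun x => 16 * (w x ^+ 2 * logpow tau (w x ^+ 2))) by exact: measurable_funM.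
have r10 x : 0 <= 9 * slope tau * (`|g x| - 1) ^+ 2 by rewrite mulr_ge0 ?sqr_ge0.
have r20 x : 0 <= 16 * (w x ^+ 2 * logpow tau (w x ^+ 2)) by rewrite mulr_ge0.
have up : (I (fun x => g x ^+ 2 * F_ tau (g x ^+ 2)) <=
    I (fun x => - slope tau + slope tau * g x ^+ 2) + I r)%E.
  apply: int_upper => //.
  - apply: measurable_funM => //; apply: measurable_funB => //.
    by apply: (measurableT_comp (measurable_logpow tau)).
  - exact: measurable_funD.
  - by move=> x; rewrite addr_ge0.
  - move=> x; apply: F_pointwise => //.
    have mx : `|m| <= 1 by exact: le_trans n1.
    rewrite /w; have := ler_normD (g x - m) m; rewrite subrK; lra.
apply: (le_trans up).
rewrite (int_L1 Lj) Rint_affine// g1 mulr1 addNr add0e.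
rewrite (int_D mu mr1 mr2 r10 r20) int_Zl//; last by move=> x; exact: sqr_ge0.
rewrite (int_Zl mu mlw (ler0n _ 16) w0) (int_L1 Ls).
have C20 : 0 <= 2 * C by rewrite mulr_ge0.
have KC0 : 0 <= K * C + K by rewrite addr_ge0// mulr_ge0.
have := lee_combine s9 (ler0n _ 16) C20 KC0 E0 Is Iw.
by rewrite (_ : 9 * slope tau * (2 * C) = 18 * slope tau * C)//; ring.
Qed.

(** Poincare's inequality for sqrt(e^2 + f^2), with e tending to 0.  Its
    gradient vanishes at the zeros of f, so the energy on the right only sees
    the set where f is nonzero, as [lenergy] does. *)
Lemma abs_variance (C : R) : 0 < C -> variance_poincare C ->
  forall f, smoothL2 mu f -> \int[mu]_x (f x ^+ 2) = 1 ->
  ((1 - (\int[mu]_x `|f x|) ^+ 2)%:E <= C%:E * lenergy mu 2 f)%E.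
Proof.
move=> C0 HP f Lf f1; have [Cf If] := Lf.
have [La _ n0 n1 _] := abs_dev_le Lf f1.
set n := \int[mu]_x `|f x| in n0 n1 *.
have E0 := lenergy_ge0 mu 2 f.
have key (e : R) : 0 < e -> ((1 - n ^+ 2 - 2 * e)%:E <= C%:E * lenergy mu 2 f)%E.
  move=> e0; pose h x := (e ^+ 2 + f x ^+ 2) `^ 2^-1.
  have D0 t : 0 < e ^+ 2 + t ^+ 2 by rewrite ltr_pwDl ?exprn_gt0// sqr_ge0.
  have h2 x : h x ^+ 2 = e ^+ 2 + f x ^+ 2 by rewrite powR_half_sqr// ltW.
  have h0 x : 0 < h x by exact: powR_gt0.
  have Ch : smooth h.
    apply: smooth_powR => //; apply: smoothD; [exact: smooth_cst|exact: smoothX].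
  have Lh : smoothL2 mu h.
    by apply: (@L2_bound _ _ mu f h (e ^+ 2) 1) => // x; rewrite h2 mul1r.
  have Ih : \int[mu]_x (h x ^+ 2) = e ^+ 2 + 1.
    rewrite (_ : (fun x => h x ^+ 2) = (fun x => e ^+ 2 + 1 * f x ^+ 2)).
      by rewrite Rint_affine// f1 mulr1.
    by apply/funext => x; rewrite h2 mul1r.
  have hn : \int[mu]_x h x <= e + n.
    have -> : e + n = \int[mu]_x (e + 1 * `|f x|) by rewrite Rint_affine// mul1r.
    apply: le_Rintegral => //; [exact: smoothL2_L1|exact: L1_affine|].
    move=> x _; rewrite mul1r; have z0 := normr_ge0 (f x).
    rewrite -(@ler_pXn2r _ 2) ?nnegrE ?(ltW (h0 x)) ?addr_ge0 ?(ltW e0)//.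
    by rewrite h2 -(real_normK (num_real (f x))); nra.
  have hn0 : 0 <= \int[mu]_x h x by apply: Rintegral_ge0 => x _; exact: ltW.
  have := HP h Lh; rewrite Ih => hv.
  apply: (@le_trans _ _ (e ^+ 2 + 1 - (\int[mu]_x h x) ^+ 2)%:E).
    by rewrite lee_fin; nra.
  apply: (le_trans hv); apply: lee_wpmul2l; first by rewrite lee_fin ltW.
  apply: le_int_ge0 => x; first exact: sqr_ge0.
  rewrite powR_mulrn ?lgrad_ge0//.
  have dh : is_derive (f x) 1 (fun t => (e ^+ 2 + t ^+ 2) `^ 2^-1) (f x / h x).
    have dD := is_derive_sqrD (e ^+ 2) (f x).
    have dA := is_derive1_comp (g := fun y => e ^+ 2 + y ^+ 2)
      (is_derive1_powR 2^-1 (D0 (f x))) dD.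
    apply: (is_derive_eq dA).
    have -> : (e ^+ 2 + f x ^+ 2) `^ (2^-1 - 1) = (h x)^-1.
      by rewrite -powRN; congr (_ `^ _); lra.
    by field; rewrite gt_eqF.
  rewrite (grad_comp Cf dh) norm2Z lgradE.
  have [fx0|fxN] := eqVneq (f x) 0.
    by rewrite fx0 mul0r normr0 mul0r expr0n/= mul0r.
  have hN : norm2 (grad f x) ^+ 2 = f x ^+ 2 * (`|f x|^-1 * norm2 (grad f x)) ^+ 2.
    rewrite exprMn exprVn real_normK ?num_real// mulrA mulfV ?mul1r//.
    by rewrite sqrf_eq0.
  rewrite -hN exprMn ler_piMl ?sqr_ge0// real_normK ?num_real//.
  by rewrite expr_div_n h2 ler_pdivrMr// mul1r lerDr sqr_ge0.
move: E0 key; case: (lenergy mu 2 f) => [y| |]//= y0 key; last first.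
  by rewrite gt0_muley ?lte_fin// leey.
rewrite -EFinM lee_fin; apply/ler_addgt0Pr => e e0.
have e2 : 0 < e / 2 by rewrite divr_gt0.
by have := key _ e2; rewrite -EFinM lee_fin; lra.
Qed.

(** The defective inequality is applied to u = [excess n f].  Its mass is at most
    2 int (|f| - 1)^2, so it is controlled by the variance of |f|, and its energy
    is at most a constant times that of f. *)
Lemma tight_log (beta K C : R) : 1 <= beta -> 0 <= K -> 0 < C ->
  (forall f, smoothL2 mu f -> \int[mu]_x (f x ^+ 2) = 1 ->
    (I (fun x => f x ^+ 2 * ln (expR 1 + f x ^+ 2)) <= K%:E + K%:E * lenergy mu beta f)%E) ->
  variance_poincare C ->
  exists C', 0 <= C' /\ forall f, smoothL2 mu f -> \int[mu]_x (f x ^+ 2) = 1 ->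
    (I (fun x => f x ^+ 2 * ln (f x ^+ 2)) <=
      C'%:E * (lenergy mu 2 f + lenergy mu beta f))%E.
Proof.
move=> b1 K0 C0 HL HP.
have [n bn] : exists n, beta <= (2 * n.+1)%:R.
  exists (Num.truncn beta); have b0 : 0 <= beta by lra.
  have /andP[_ h] := truncn_itv b0.
  by apply: (le_trans (ltW h)); rewrite ler_nat mul2n -addnn leq_addr.
pose A : R := 4 ^+ (2 * n.+2); have A0 : 0 <= A by exact: exprn_ge0.
pose Q : R := (4 * n.+1%:R) `^ beta; have Q0 : 0 <= Q by exact: powR_ge0.
pose C1 := 18 * C + A * (K * (4 * C)); pose C2 := A * (K * Q).
have C0' := ltW C0.
have q0 : 0 <= K * (4 * C) by rewrite mulr_ge0// mulr_ge0.
have p0 : 0 <= 18 * C by rewrite mulr_ge0.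
have C10 : 0 <= C1 := addr_ge0 p0 (mulr_ge0 A0 q0).
have C20 : 0 <= C2 := mulr_ge0 A0 (mulr_ge0 K0 Q0).
exists (C1 + C2); split; first exact: addr_ge0.
move=> f Lf f1; have [Cf If] := Lf.
have [La Ls n0 n1 sE] := abs_dev_le Lf f1.
have var := abs_variance C0 HP Lf f1.
set N := \int[mu]_x `|f x| in n0 n1 sE var.
have E20 := lenergy_ge0 mu 2 f; have Eb0 := lenergy_ge0 mu beta f.
have ms := L1_measurable Ls.
pose u x := excess n (f x).
have Cu : smooth u.
  have CD : smooth (fun x => 1 + f x ^+ 2).
    by apply: smoothD; [exact: smooth_cst|exact: smoothX].
  apply: smoothM; first by apply: smooth_powR => // x; exact: sqr1_gt0.
  apply: smoothX; apply: smoothM; last by apply: smooth_powR => // x; exact: sqr1_gt0.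
  by apply: smoothD; [exact: smoothX|exact: smooth_cst].
have Lu2 : L1 (fun x => u x ^+ 2).
  apply: (@L1_le _ _ _ mu _ (fun x => 0 + 2 * (`|f x| - 1) ^+ 2)).
  - by apply: measurable_funX; exact: smooth_measurable.
  - exact: L1_affine.
  - by move=> x; rewrite ger0_norm ?sqr_ge0// add0r; exact: excess_sqr_le.
have Lu : smoothL2 mu u by split.
have Iu : \int[mu]_x (u x ^+ 2) <= 2 * (2 - 2 * N).
  have -> : 2 * (2 - 2 * N) = \int[mu]_x (0 + 2 * (`|f x| - 1) ^+ 2).
    by rewrite Rint_affine// sE add0r.
  apply: le_Rintegral => //; first exact: L1_affine.
  by move=> x _; rewrite add0r; exact: excess_sqr_le.
have mu2 := smoothL2_sqr_measurable Lu; have mf2 := smoothL2_sqr_measurable Lf.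
pose Psi (t : R) := ln (expR 1 + t).
have mPsi : measurable_fun [set: R] Psi.
  by apply: (measurableT_comp (@measurable_ln R)); exact: measurable_funD.
have Psi0 t : 0 <= t -> 0 <= Psi t by move=> t0; have := ln_e_ge1 t0; rewrite /Psi; lra.
have Psi_nd s t : 0 <= s -> s <= t -> Psi s <= Psi t.
  move=> s0 st; rewrite /Psi ler_ln ?posrE ?lerD2l ?ltr_wpDr ?expR_gt0//.
  exact: le_trans st.
have u4 : \int[mu]_x (u x ^+ 2) <= 4 by lra.
have mG : meas (fun x => u x ^+ 2 * ln (expR 1 + u x ^+ 2 / 4)).
  apply: measurable_funM => //; apply: measurable_ln_comp; apply: measurable_funD => //.
  exact: measurable_funM.
have G0 x : 0 <= u x ^+ 2 * ln (expR 1 + u x ^+ 2 / 4).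
  by rewrite mulr_ge0 ?sqr_ge0//; apply: (Psi0 _); rewrite divr_ge0 ?sqr_ge0.
have IG : (I (fun x => u x ^+ 2 * ln (expR 1 + u x ^+ 2 / 4)) <=
    (K * (4 * C))%:E * lenergy mu 2 f + (K * Q)%:E * lenergy mu beta f)%E.
  have := @homogenize_le _ _ mu Psi mPsi (lenergy mu beta)
    (lenergy_ge0 mu beta) (lenergy_Z mu beta) K K K0 K0 HL Psi_nd u 4 Lu (ltr0n _ 4) u4.
  move=> h; apply: (le_trans h); apply: leeD.
    rewrite !EFinM -!muleA; apply: lee_wpmul2l => //.
    apply: (@le_trans _ _ (4%:E * (1 - N ^+ 2)%:E)%E); first by rewrite -EFinM lee_fin; nra.
    exact: lee_wpmul2l.
  rewrite EFinM -muleA; apply: lee_wpmul2l => //.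
  rewrite /lenergy -int_Zl//; last 2 first.
  - exact: measurable_lenergy.
  - by move=> x; rewrite mulr_ge0 ?sqr_ge0 ?powR_ge0.
  apply: le_int_ge0 => x; first by rewrite mulr_ge0 ?sqr_ge0 ?powR_ge0.
  apply: (lgrad_comp_le Cf _ Q0 (excess_derive n (f x))).
  - by rewrite gt_eqF//; lra.
  - by move=> ->; rewrite !(mul0r, mulr0).
  - exact: excess_energy.
have Lj : L1 (fun x => - 1 + 1 * f x ^+ 2) by exact: L1_affine.
have mr1 : meas (fun x => 9 * (`|f x| - 1) ^+ 2) by exact: measurable_funM.
have mr2 : meas (fun x => A * (u x ^+ 2 * ln (expR 1 + u x ^+ 2 / 4))).
  exact: measurable_funM.
have r10 x : 0 <= 9 * (`|f x| - 1) ^+ 2 by rewrite mulr_ge0 ?sqr_ge0.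
have r20 x : 0 <= A * (u x ^+ 2 * ln (expR 1 + u x ^+ 2 / 4)) by rewrite mulr_ge0.
have up : (I (fun x => f x ^+ 2 * ln (f x ^+ 2)) <= I (fun x => - 1 + 1 * f x ^+ 2) +
    I (fun x => 9 * (`|f x| - 1) ^+ 2 +
      A * (u x ^+ 2 * ln (expR 1 + u x ^+ 2 / 4))))%E.
  apply: int_upper => //.
  - by apply: measurable_funM => //; exact: measurable_ln_comp.
  - exact: measurable_funD.
  - by move=> x; rewrite addr_ge0.
  - by move=> x; exact: entropy_pointwise.
apply: (le_trans up); rewrite (int_L1 Lj) Rint_affine// f1 mulr1 addNr add0e.
rewrite (int_D mu mr1 mr2 r10 r20) int_Zl//; last by move=> x; exact: sqr_ge0.
rewrite (int_Zl mu mG A0 G0) (int_L1 Ls) sE.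
have part1 : (9%:E * (2 - 2 * N)%:E <= (18 * C)%:E * lenergy mu 2 f)%E.
  apply: (@le_trans _ _ (18%:E * (1 - N ^+ 2)%:E)%E); first by rewrite -!EFinM lee_fin; nra.
  by rewrite EFinM -muleA; apply: lee_wpmul2l.
rewrite /C1 /C2.
exact: (lee_combine_sum A0 p0 q0 (mulr_ge0 K0 Q0) E20 Eb0 part1 IG).
Qed.

End tightening.

(** * Conclusion *)

Section conclusion.
Context {R : realType} (d : nat) (mu : probability 'rV[R]_d R).
Implicit Types f g : 'rV[R]_d -> R.
Local Notation meas f := (measurable_fun [set: 'rV[R]_d] f).
Local Notation I f := (\int[mu]_x (f%R x)%:E)%E.

Lemma measurable_F tau : measurable_fun [set: R] (@F_ R tau).
Proof. by apply: measurable_funB => //; exact: measurable_logpow. Qed.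

Lemma ineq_F_of_normalized tau B C : 0 <= B -> 0 <= C ->
  (forall g, smoothL2 mu g -> \int[mu]_x (g x ^+ 2) = 1 ->
    (I (fun x => g x ^+ 2 * F_ tau (g x ^+ 2)) <= B%:E + C%:E * dirichlet mu g)%E) ->
  ineq_F mu tau B C.
Proof.
move=> B0 C0 H g Lg.
exact: (homogenize (measurable_F tau) (dirichlet_ge0 mu) (dirichlet_Z mu) B0 C0 H Lg).
Qed.

(** The constant beta is moved to the measurable side before the integrands are
    compared. *)
Lemma lenergy_conjugate p beta alpha f : smooth f -> 0 < beta ->
  (forall x, 0 <= x -> x `^ p <= beta * conjugate (cost alpha) x) ->
  (lenergy mu p f <= beta%:E * I (fun x => f x ^+ 2 *
      conjugate (cost alpha) (norm2 ((f x)^-1 *: grad f x))))%E.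
Proof.
move=> Cf b0 H.
have E0 x : 0 <= f x ^+ 2 * lgrad f x `^ p by rewrite mulr_ge0 ?sqr_ge0 ?powR_ge0.
have bV0 : 0 <= beta^-1 by rewrite invr_ge0 ltW.
have -> : lenergy mu p f = (beta%:E * I (fun x => beta^-1 * (f x ^+ 2 * lgrad f x `^ p)))%E.
  rewrite int_Zl//; last exact: measurable_lenergy.
  by rewrite muleA -EFinM mulfV ?gt_eqF// mul1e.
apply: lee_wpmul2l; first by rewrite lee_fin ltW.
apply: le_int_ge0 => x; first exact: mulr_ge0.
rewrite mulrCA ler_wpM2l ?sqr_ge0// ler_pdivrMl//.
by apply: H; exact: lgrad_ge0.
Qed.

Lemma ineq_mLS_of_normalized p alpha beta B C : 1 < alpha -> alpha <= 2 ->
  beta = alpha / (alpha - 1) -> p = 2 \/ p = beta -> 0 <= B -> 0 <= C ->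
  (forall f, smoothL2 mu f -> \int[mu]_x (f x ^+ 2) = 1 ->
    (I (fun x => f x ^+ 2 * ln (f x ^+ 2)) <=
      B%:E + C%:E * (lenergy mu p f + lenergy mu beta f))%E) ->
  ineq_mLS mu alpha B (C * (2 * beta)).
Proof.
move=> a1 a2 bE pb B0 C0 H f Lf; have [Cf _] := Lf.
have b0 : 0 < beta by rewrite bE divr_gt0; lra.
have cl x (x0 : 0 <= x) := conjugate_lower a1 a2 x0; rewrite -/beta /= -bE in cl.
pose Q f := (lenergy mu p f + lenergy mu beta f)%E.
have Q0 g : (0 <= Q g)%E by rewrite adde_ge0 ?lenergy_ge0.
have QZ c g : c != 0 -> smooth g -> Q (fun x => c * g x) = ((c ^+ 2)%:E * Q g)%E.
  by move=> c0 Cg; rewrite ge0_muleDr ?lenergy_ge0//; congr (_ + _)%E; exact: lenergy_Z.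
have := homogenize (@measurable_ln R) Q0 QZ B0 C0 H Lf => h.
apply: (le_trans h); apply: leeD => //.
rewrite EFinM -muleA; apply: lee_wpmul2l; first by rewrite lee_fin.
rewrite EFinM -muleA (_ : 2%:E = 1%:E + 1%:E)%E; last by rewrite -EFinD.
rewrite ge0_muleDl ?lee_fin// !mul1e; apply: leeD; apply: lenergy_conjugate => // x x0.
- case: pb => ->; last by have [] := cl x x0.
  by rewrite powR_mulrn//; have [] := cl x x0.
- by have [] := cl x x0.
Qed.

End conclusion.

Theorem theorem4p1 (R : realType) (d : nat) (tau alpha : R)
    (htau : 0 < tau <= 1) (halpha : 1 < alpha <= 2)
    (htau_alpha : tau = 2 * (alpha - 1) / alpha)
    (mu : probability 'rV[R]_d R) (hac : mu `<< lebesgue_rV d)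
    (hI : ineq_I mu tau) :
  (exists B1 C1 B2 C2 : R,
     ineq_F mu tau B1 C1 /\ ineq_mLS mu alpha B2 C2) /\
  (local_poincare mu ->
   exists C1 C2 : R, ineq_F mu tau 0 C1 /\ ineq_mLS mu alpha 0 C2).
Proof.
have /andP[tau0 tau1] := htau; have /andP[a1 a2] := halpha.
have bE : 2 / tau = alpha / (alpha - 1).
  by rewrite htau_alpha; field; rewrite !gt_eqF; lra.
have b1 : 1 <= 2 / tau by rewrite ler_pdivlMr//; lra.
have [K [K0 HF]] := defective_F tau0 tau1 hI.
have [K' [K'0 HL]] := defective_log tau0 tau1 hI.
split.
  exists K, K, K', (K' * (2 * (2 / tau))); split.
    apply: ineq_F_of_normalized => // g Lg g1; apply: le_trans (HF g Lg g1).
    have m2 := smoothL2_sqr_measurable Lg.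
    apply: le_int => [||x].
    - by apply: measurable_funM => //; apply: (measurableT_comp (measurable_F tau)).
    - by apply: measurable_funM => //; apply: (measurableT_comp (measurable_logpow tau)).
    - by rewrite ler_wpM2l ?sqr_ge0// /F_ gerBl powR_ge0.
  apply: (@ineq_mLS_of_normalized _ _ _ (2 / tau)) => //; first by right.
  move=> f Lf f1; have m2 := smoothL2_sqr_measurable Lf.
  apply: (@le_trans _ _ (K'%:E + K'%:E * lenergy mu (2 / tau) f)%E).
    apply: le_trans (HL f Lf f1); apply: le_int => [||x].
    - by apply: measurable_funM => //; exact: measurable_ln_comp.
    - apply: measurable_funM => //; apply: measurable_ln_comp.
      exact: measurable_funD.
    - have [->|fx0] := eqVneq (f x) 0; first by rewrite expr0n/= !mul0r.
      have f20 : 0 < f x ^+ 2 by rewrite exprn_even_gt0.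
      rewrite ler_wpM2l ?sqr_ge0// ler_ln ?posrE//; last by rewrite addr_gt0 ?expR_gt0.
      by rewrite lerDr expR_ge0.
  apply: leeD => //; apply: lee_wpmul2l => //.
  by rewrite leeDl ?lenergy_ge0.
move=> hloc.
have [C [C0 HP]] := poincare_normalized tau0 K0 HF hloc.
have C1 : 0 < C + 1 by lra.
have HV : variance_poincare mu (C + 1).
  apply: poincare_variance; first exact: ltW.
  move=> u Lu u1 u0; apply: le_trans (HP u Lu u1 u0) _.
  by apply: lee_wpmul2r; rewrite ?dirichlet_ge0// lee_fin; lra.
have [C' [C'0 HT]] := tight_log b1 K'0 C1 HL HV.
exists (18 * slope tau * (C + 1) + 16 * (K * (C + 1) + K)), (C' * (2 * (2 / tau))); split.
  apply: ineq_F_of_normalized => //.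
    have s0 := slope_ge0 tau0.
    have := mulr_ge0 s0 (ltW C1); have := mulr_ge0 K0 (ltW C1); lra.
  move=> g Lg g1; rewrite add0e.
  exact: (tight_F tau0 tau1 K0 (ltW C1) HF HV Lg g1).
apply: (@ineq_mLS_of_normalized _ _ _ 2) => //; first by left.
by move=> f Lf f1; rewrite add0e; exact: HT.
Qed.
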